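(* Let $\mu\in\mathbb{C}$, $b\in\mathbb{C}\setminus\{0,-1,-2,\ldots\}$, $\gamma\in\mathbb{C}\setminus\{0\}$, $\lambda\ge 0$. Let $\phi(z)=1+B_1z+B_2z^2+\cdots$ be analytic in the open unit disk $\triangle$ with $B_1>0$, and let $\psi(z)=C_0+C_1z+C_2z^2+\cdots$ be analytic in $\triangle$ with $|\psi(z)|<1$. If $f(z)=z+\sum_{n\ge 2}a_nz^n$ belongs to the class $\mathcal{B}^{\mu,b}_{\Sigma}(\gamma,\lambda,\phi)$ (with quasi-subordination multiplier $\psi$), then $$|a_2|\le \frac{|\gamma|\,|C_0|\,B_1\sqrt{2B_1}}{\sqrt{\left|\gamma C_0B_1^2\left[(\lambda-1)(\lambda+2)\Theta_2^2+2(\lambda+2)\Theta_3\right]-2(B_2-B_1)(1+\lambda)^2\Theta_2^2\right|}}$$ and $$|a_3|\le \frac{|\gamma||C_0|B_1}{(\lambda+2)\Theta_3}+\frac{|\gamma||C_1|B_1}{(\lambda+2)\Theta_3}+\left(\frac{|\gamma||C_0|B_1}{(1+\lambda)\Theta_2}\right)^2 .$$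
   Context: $\triangle=\{z\in\mathbb{C}:|z|<1\}$. $\mathcal{A}$ is the class of functions $f(z)=z+\sum_{n\ge2}a_nz^n$ analytic in $\triangle$. A function $f\in\mathcal{A}$ is bi-univalent if $f$ is univalent in $\triangle$ and its inverse $f^{-1}$ (defined near $0$, on a disk of radius at least $1/4$) extends to a univalent function in $\triangle$; $\Sigma$ is the class of bi-univalent functions. For $f\in\Sigma$, $g=f^{-1}$ (as extended to $\triangle$), so $g(w)=w-a_2w^2+(2a_2^2-a_3)w^3-\cdots$. The (Srivastava–Attiya type) operator $\mathcal{J}_\mu^b:\mathcal{A}\to\mathcal{A}$ is $\mathcal{J}_\mu^bf(z)=z+\sum_{k\ge2}\Theta_ka_kz^k$, where $\Theta_k=\left|\left(\frac{1+b}{k+b}\right)^{\mu}\right|$ (principal power). Quasi-subordination: with the fixed analytic function $\psi(z)=C_0+C_1z+C_2z^2+\cdots$, $|\psi(z)|<1$ in $\triangle$, $F\prec_{\widetilde q}h$ means that there is an analytic $u$ in $\triangle$ with $u(0)=0$, $|u(z)|<1$, such that $F(z)=\psi(z)\,h(u(z))$ for all $z\in\triangle$. The same multiplier $\psi$ is used in both conditions below (the functions $u$ may differ). Class $\mathcal{B}^{\mu,b}_{\Sigma}(\gamma,\lambda,\phi)$: all $f\in\Sigma$ such that, with $g=f^{-1}$, $$\frac1\gamma\left(\frac{z^{1-\lambda}(\mathcal{J}_\mu^bf(z))'}{[\mathcal{J}_\mu^bf(z)]^{1-\lambda}}-1\right)\prec_{\widetilde q}\phi(z)-1,\qquad \frac1\gamma\left(\frac{w^{1-\lambda}(\mathcal{J}_\mu^bg(w))'}{[\mathcal{J}_\mu^bg(w)]^{1-\lambda}}-1\right)\prec_{\widetilde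 q}\phi(w)-1\qquad(z,w\in\triangle).$$ Here the quotient $z^{1-\lambda}F'(z)/F(z)^{1-\lambda}$ is understood as $F'(z)\,(F(z)/z)^{\lambda-1}$, with the analytic branch equal to $1$ at $z=0$. *)

(* Defs.v *)
From Stdlib Require Import Reals.
From Coquelicot Require Import Coquelicot.

Open Scope C_scope.

Definition unit_disk (z : C) : Prop := (Cmod z < 1)%R.

(* Coquelicot has no complex exponential or logarithm. *)
Definition Cexp (z : C) : C :=
  ((exp (Re z) * cos (Im z))%R, (exp (Re z) * sin (Im z))%R).

(* Principal argument, with values in (-PI, PI]; meaningful for z <> 0. *)
Definition Carg (z : C) : R :=
  if Rlt_dec (Im z) 0 then (- acos (Re z / Cmod z))%R
  else acos (Re z / Cmod z).

Definition Clog (z : C) : C := (ln (Cmod z), Carg z).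

Definition Cpower (z w : C) : C := Cexp (w * Clog z).

(* Analytic means complex differentiable at every point of the disk. *)
Definition analytic (f : C -> C) : Prop :=
  forall z : C, unit_disk z -> ex_derive (K := C_AbsRing) (V := C_NormedModule) f z.

Definition analytic_series (f : C -> C) (a : nat -> C) : Prop :=
  analytic f /\
  forall z : C, unit_disk z ->
    is_pseries (K := C_AbsRing) (V := C_NormedModule) a z (f z).

Definition univalent (f : C -> C) : Prop :=
  analytic f /\
  forall z w : C, unit_disk z -> unit_disk w -> f z = f w -> z = w.

Definition class_A (f : C -> C) (a : nat -> C) : Prop :=
  a 0%nat = 0 /\ a 1%nat = 1 /\ analytic_series f a.

(* Since f is injective on the disk, the condition near 0 says that w lies in
   the image of the disk and that g w is its unique preimage there. *)
Definition univalent_inverse (f g : C -> C) : Prop :=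
  univalent g /\ locally (RtoC 0) (fun w : C => unit_disk (g w) /\ f (g w) = w).

Definition bi_univalent_with_inverse (f g : C -> C) : Prop :=
  (exists a, class_A f a) /\ univalent f /\ univalent_inverse f g.

Definition Theta (mu b : C) (k : nat) : R :=
  Cmod (Cpower ((1 + b) / (RtoC (INR k) + b)) mu).

Definition J_coef (mu b : C) (a : nat -> C) (k : nat) : C :=
  match k with
  | 0%nat => 0
  | 1%nat => 1
  | _ => RtoC (Theta mu b k) * a k
  end.

(* F is the image of f under the operator; this determines F on the disk. *)
Definition is_J (mu b : C) (f F : C -> C) : Prop :=
  exists a, class_A f a /\ class_A F (J_coef mu b a).

(* P is the analytic branch on the disk of (F z / z)^s with value 1 at 0. As
   F z / z tends to 1 at 0, that branch is the principal power near 0, and this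
   determines P on the whole disk. *)
Definition analytic_branch (F : C -> C) (s : R) (P : C -> C) : Prop :=
  analytic P /\ P 0 = 1 /\
  locally' (RtoC 0) (fun z : C => P z = Cpower (F z / z) (RtoC s)).

Definition quasi_subordinate (psi F h : C -> C) : Prop :=
  exists u : C -> C,
    analytic u /\ u 0 = 0 /\
    (forall z, unit_disk z -> (Cmod (u z) < 1)%R) /\
    (forall z, unit_disk z -> F z = psi z * h (u z)).

Definition B_condition (mu b gamma : C) (lam : R) (phi psi f : C -> C) : Prop :=
  exists F P : C -> C,
    is_J mu b f F /\
    analytic_branch F (lam - 1) P /\
    quasi_subordinate psi
      (fun z => 1 / gamma * (C_derive F z * P z - 1)) (fun z => phi z - 1).

Definition class_B_Sigma (mu b gamma : C) (lam : R) (phi psi f : C -> C) : Prop :=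
  exists g : C -> C,
    bi_univalent_with_inverse f g /\
    B_condition mu b gamma lam phi psi f /\
    B_condition mu b gamma lam phi psi g.

(* Main.v *)
Require Import Defs.
From Stdlib Require Import Reals.
From Coquelicot Require Import Coquelicot.
From Stdlib Require Import Lra Lia ClassicalEpsilon.

(** Expanding both subordinations to second order at 0, with
    u(z) = u1 z + u2 z^2 + ... and v(w) = v1 w + v2 w^2 + ... the two Schwarz
    functions and g(w) = w - a2 w^2 + (2 a2^2 - a3) w^3 + ..., gives four
    equations.  The first-order ones yield v1 = - u1 when C0 <> 0; the sum of
    the second-order ones then expresses a2^2 D through
    (u2 + u1^2) + (v2 + v1^2), and their difference expresses a3 - a2^2.  Both
    bounds follow from |u2| <= 1 - |u1|^2 and |v2| <= 1 - |v1|^2.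

    The Schwarz functions are only assumed complex differentiable, so this
    coefficient inequality rests on Goursat's theorem.  In the coordinate
    log z it shows that the mean of Re K over a circle about 0 does not depend
    on the radius; applied to a suitable K built from u, this replaces the
    maximum principle and the Schwarz-Pick lemma. *)

Open Scope R_scope.


(** The difference B2 - B1 in the first bound has a simple origin. In the sum of the second-order
    equations the C1 terms cancel because v1 = - u1, leaving C0 times B1 (u2 + v2) + 2 B2 u1^2.
    Completing u2 and v2 to u2 + u1^2 and v2 + u1^2 costs 2 (B2 - B1) u1^2, and the first-order
    equation makes u1^2 a multiple of a2^2. Each completed term has modulus at most 1, hence the
    total 2. When C0 = 0 the relation v1 = - u1 is lost, but then a2 = 0 and the equations for f
    alone suffice.

    Power series are given for f, g, phi and psi but not for u and v. All expansions are therefore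
    2-jets at 0 whose remainder factor is merely continuous there; a3 comes within their reach after
    division by z.

    The coefficient inequality is a duality argument: |u2| + 2 |u1|^2 is the real part of a mean of
    u(z)/z against a kernel that is a unimodular factor times a square, and the modulus of this
    kernel has mean 1 + |u1|^2. *)

(** * Continuity, complex differentiability and 2-jets at 0 *)

Lemma Ceq_dec (x y : C) : {x = y} + {x <> y}.
Proof.
destruct x as [a b], y as [c d].
destruct (Req_EM_T a c) as [->|n]; [|right; congruence].
destruct (Req_EM_T b d) as [->|n]; [now left | right; congruence].
Qed.

Lemma Ceq_dec_refl (T : Type) (z : C) (a b : T) :
  (if Ceq_dec z z then a else b) = a.
Proof. now destruct (Ceq_dec z z). Qed.

(* Continuity for the modulus, the structure on which [is_derive] over C is
   built, and not for Coquelicot's product structure on pairs. *)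
Definition ccont (f : C -> C) (z : C) : Prop :=
  @continuous (AbsRing_UniformSpace C_AbsRing) (AbsRing_UniformSpace C_AbsRing) f z.

Lemma ccontP (f : C -> C) (z : C) :
  ccont f z <->
  forall eps, 0 < eps -> exists d, 0 < d /\
    forall w, Cmod (w - z) < d -> Cmod (f w - f z) < eps.
Proof.
split.
- intros H eps He.
  destruct (proj1 (@filterlim_locally C (AbsRing_UniformSpace C_AbsRing) _ _ _ _) H (mkposreal eps He)) as [d Hd].
  exists d; split; [apply cond_pos | exact Hd].
- intros H; apply filterlim_locally; intros eps.
  destruct (H eps (cond_pos eps)) as [d [Hd Hw]].
  exists (mkposreal d Hd); exact Hw.
Qed.

Lemma ccont_const (c z : C) : ccont (fun _ => c) z.
Proof. exact (@continuous_const (AbsRing_UniformSpace C_AbsRing) (AbsRing_UniformSpace C_AbsRing) c z). Qed.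

Lemma ccont_id (z : C) : ccont (fun w => w) z.
Proof. exact (@continuous_id (AbsRing_UniformSpace C_AbsRing) z). Qed.

Lemma ccont_plus (f g : C -> C) (z : C) :
  ccont f z -> ccont g z -> ccont (fun w => f w + g w)%C z.
Proof. exact (@continuous_plus (AbsRing_UniformSpace C_AbsRing) _ (AbsRing_NormedModule C_AbsRing) f g z). Qed.

Lemma ccont_opp (f : C -> C) (z : C) : ccont f z -> ccont (fun w => - f w)%C z.
Proof. exact (@continuous_opp (AbsRing_UniformSpace C_AbsRing) _ (AbsRing_NormedModule C_AbsRing) f z). Qed.

Lemma ccont_minus (f g : C -> C) (z : C) :
  ccont f z -> ccont g z -> ccont (fun w => f w - g w)%C z.
Proof. intros; apply ccont_plus, ccont_opp; assumption. Qed.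

Lemma ccont_mult (f g : C -> C) (z : C) :
  ccont f z -> ccont g z -> ccont (fun w => f w * g w)%C z.
Proof. exact (@continuous_mult (AbsRing_UniformSpace C_AbsRing) C_AbsRing f g z). Qed.

Lemma ccont_comp (f g : C -> C) (z : C) :
  ccont f z -> ccont g (f z) -> ccont (fun w => g (f w)) z.
Proof. exact (@continuous_comp (AbsRing_UniformSpace C_AbsRing) (AbsRing_UniformSpace C_AbsRing) (AbsRing_UniformSpace C_AbsRing) f g z). Qed.

Lemma ccont_ext_loc (f g : C -> C) (z : C) :
  (exists d, 0 < d /\ forall w, Cmod (w - z) < d -> f w = g w) ->
  ccont f z -> ccont g z.
Proof.
intros [d [Hd H]] Hf; apply ccontP; intros eps He.
destruct (proj1 (ccontP f z) Hf eps He) as [d' [Hd' H']].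
exists (Rmin d d'); split; [now apply Rmin_pos|].
intros w Hw.
assert (Hz : Cmod (z - z) < d).
{ replace (z - z)%C with (RtoC 0) by ring; rewrite Cmod_0; exact Hd. }
rewrite <- !H; auto.
- apply H'; eapply Rlt_le_trans; [exact Hw | apply Rmin_r].
- eapply Rlt_le_trans; [exact Hw | apply Rmin_l].
Qed.

Lemma ccont_inv (f : C -> C) (z : C) :
  ccont f z -> f z <> 0 -> ccont (fun w => / f w)%C z.
Proof.
intros Hf H0; apply ccontP; intros eps He.
assert (Hm : 0 < Cmod (f z)) by now apply Cmod_gt_0.
set (m := Cmod (f z)) in *.
destruct (proj1 (ccontP f z) Hf (Rmin (m / 2) (eps * (m * m) / 2))) as [d [Hd H]].
{ apply Rmin_pos; [lra|]. apply Rdiv_lt_0_compat; [|lra]. now repeat apply Rmult_lt_0_compat. }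
exists d; split; [exact Hd|]; intros w Hw; specialize (H w Hw).
assert (H1 : Cmod (f w - f z) < m / 2) by (eapply Rlt_le_trans; [exact H | apply Rmin_l]).
assert (H2 : Cmod (f w - f z) < eps * (m * m) / 2) by (eapply Rlt_le_trans; [exact H | apply Rmin_r]).
assert (H3 : m / 2 < Cmod (f w)).
{ assert (m <= Cmod (f w) + Cmod (f w - f z)); [|lra].
  unfold m; replace (f z) with (f w + - (f w - f z))%C at 1 by ring.
  eapply Rle_trans; [apply Cmod_triangle|]; rewrite Cmod_opp; lra. }
assert (Hw0 : f w <> 0) by (apply Cmod_gt_0; lra).
replace (/ f w - / f z)%C with (- (f w - f z) / (f w * f z))%C by (field; auto).
rewrite Cmod_div by (apply Cmult_neq_0; assumption).
rewrite Cmod_opp, Cmod_mult; fold m.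
apply Rlt_div_l; [nra|].
eapply Rlt_trans; [exact H2|].
replace (eps * (m * m) / 2) with (eps * (m / 2 * m)) by field.
apply Rmult_lt_compat_l; [lra|]; apply Rmult_lt_compat_r; lra.
Qed.

Ltac ccont_tac :=
  lazymatch goal with
  | |- ccont (fun _ => ?c) _ => apply ccont_const
  | |- ccont (fun w => w) _ => apply ccont_id
  | |- ccont (fun w => (_ * _)%C) _ => apply ccont_mult; ccont_tac
  | |- ccont (fun w => (_ + _)%C) _ => apply ccont_plus; ccont_tac
  | |- ccont (fun w => (_ - _)%C) _ => apply ccont_minus; ccont_tac
  | |- ccont (fun w => (- _)%C) _ => apply ccont_opp; ccont_tac
  | |- ccont (Cmult ?c) _ => apply (ccont_mult (fun _ => c) (fun w => w)); ccont_tac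
  | |- ccont (Cplus ?c) _ => apply (ccont_plus (fun _ => c) (fun w => w)); ccont_tac
  | _ => assumption
  end.

(* Caratheodory's form of differentiability turns the product and chain rules
   into algebraic identities. *)
Definition cdiff (f : C -> C) (z : C) : Prop :=
  exists q, ccont q z /\ forall w, f w = (f z + (w - z) * q w)%C.

Lemma is_derive_caratheodory (f : C -> C) (z l : C) :
  is_derive (K := C_AbsRing) (V := C_NormedModule) f z l ->
  exists q, ccont q z /\ q z = l /\ forall w, f w = (f z + (w - z) * q w)%C.
Proof.
intros [_ H].
exists (fun w => if Ceq_dec w z then l else (f w - f z) / (w - z))%C.
split; [|split; [apply Ceq_dec_refl|]].
- apply ccontP; rewrite Ceq_dec_refl; intros eps He.
  assert (He2 : 0 < eps / 2) by lra.
  destruct (H z (fun P HP => HP) (mkposreal _ He2)) as [d Hd].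
  exists d; split; [apply cond_pos|]; intros w Hw.
  destruct (Ceq_dec w z) as [->|n].
  { replace (l - l)%C with (RtoC 0) by ring; rewrite Cmod_0; exact He. }
  specialize (Hd w Hw).
  change (Cmod ((f w - f z) - (w - z) * l)%C <= eps / 2 * Cmod (w - z)) in Hd.
  assert (Hn : (w - z)%C <> 0).
  { intro E; apply n; replace w with ((w - z) + z)%C by ring; rewrite E; ring. }
  assert (Hp : 0 < Cmod (w - z)) by now apply Cmod_gt_0.
  replace ((f w - f z) / (w - z) - l)%C
    with (((f w - f z) - (w - z) * l) / (w - z))%C by (field; exact Hn).
  rewrite Cmod_div by exact Hn.
  apply Rlt_div_l; nra.
- intros w; destruct (Ceq_dec w z) as [->|n]; [ring|].
  field; intro E; apply n; replace w with ((w - z) + z)%C by ring; rewrite E; ring.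
Qed.

Lemma ccont_of_slope (f q : C -> C) (z : C) :
  ccont q z -> (forall w, f w = f z + (w - z) * q w)%C -> ccont f z.
Proof.
intros Hq H; apply ccont_ext_loc with (fun w => f z + (w - z) * q w)%C.
- exists 1; split; [lra | intros; symmetry; apply H].
- ccont_tac.
Qed.

Lemma cdiff_cont (f : C -> C) (z : C) : cdiff f z -> ccont f z.
Proof. intros [q [Hq H]]; now apply ccont_of_slope with q. Qed.

Lemma cdiff_analytic (f : C -> C) (z : C) : analytic f -> unit_disk z -> cdiff f z.
Proof.
intros Hf Hz; destruct (Hf z Hz) as [l Hl].
destruct (is_derive_caratheodory f z l Hl) as [q [Hq [_ H]]]; now exists q.
Qed.

Lemma cdiff_mult (f g : C -> C) (z : C) :
  cdiff f z -> cdiff g z -> cdiff (fun w => f w * g w)%C z.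
Proof.
intros [p [Hp Hf]] [q [Hq Hg]].
exists (fun w => p w * g z + f z * q w + (w - z) * p w * q w)%C; split.
- ccont_tac.
- intros w; rewrite (Hf w), (Hg w); ring.
Qed.

Lemma cdiff_plus (f g : C -> C) (z : C) :
  cdiff f z -> cdiff g z -> cdiff (fun w => f w + g w)%C z.
Proof.
intros [p [Hp Hf]] [q [Hq Hg]].
exists (fun w => p w + q w)%C; split.
- ccont_tac.
- intros w; rewrite (Hf w), (Hg w); ring.
Qed.

Lemma cdiff_const (c z : C) : cdiff (fun _ => c) z.
Proof. exists (fun _ => 0); split; [ccont_tac | intros; ring]. Qed.

Lemma cdiff_id (z : C) : cdiff (fun w => w) z.
Proof. exists (fun _ => 1); split; [ccont_tac | intros; ring]. Qed.

Lemma cdiff_comp (f g : C -> C) (z : C) :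
  cdiff f z -> cdiff g (f z) -> cdiff (fun w => g (f w)) z.
Proof.
intros Hf Hg; assert (Hc := cdiff_cont f z Hf); revert Hf Hg.
intros [p [Hp Hf]] [q [Hq Hg]].
exists (fun w => p w * q (f w))%C; split.
- apply ccont_mult; [assumption | now apply ccont_comp].
- intros w; rewrite (Hg (f w)).
  replace (f w - f z)%C with ((w - z) * p w)%C by (rewrite (Hf w); ring); ring.
Qed.

Lemma cdiff_inv (z : C) : z <> 0 -> cdiff Cinv z.
Proof.
intros Hz.
(* The slope identity is required at every [w], so at [w = 0] the slope must reproduce whatever
   value [/ 0] has. Continuity at [z] does not see this point, as [z] is not 0. *)
exists (fun w => if Ceq_dec w 0 then (/ 0 - / z) / (0 - z) else - / (w * z))%C; split.
- apply ccont_ext_loc with (fun w => - / (w * z))%C.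
  + exists (Cmod z); split; [now apply Cmod_gt_0|].
    intros w Hw; destruct (Ceq_dec w 0) as [->|n]; [|reflexivity].
    exfalso; replace (0 - z)%C with (- z)%C in Hw by ring; rewrite Cmod_opp in Hw; lra.
  + apply ccont_opp, ccont_inv; [ccont_tac|].
    now apply Cmult_neq_0.
- intros w; destruct (Ceq_dec w 0) as [->|n].
  + assert (0 - z <> 0)%C.
    { intro E; apply Hz; replace z with (- (0 - z))%C by ring; rewrite E; ring. }
    set (i := Cinv 0). field; auto.
  + field; auto.
Qed.

(* The identity may be required for all z because q is unconstrained away
   from 0. *)
Definition jet2 (f : C -> C) (a0 a1 a2 : C) : Prop :=
  exists q, ccont q 0 /\ q 0 = a2 /\ forall z, f z = (a0 + a1 * z + z * z * q z)%C.

Lemma jet2_ext_loc (f g : C -> C) (a0 a1 a2 : C) :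
  (exists d, 0 < d /\ forall w, Cmod w < d -> f w = g w) ->
  jet2 f a0 a1 a2 -> jet2 g a0 a1 a2.
Proof.
intros [d [Hd H]] [q [Hq [H2 Hf]]].
exists (fun z => if Ceq_dec z 0 then a2 else (g z - a0 - a1 * z) / (z * z))%C.
split; [|split; [apply Ceq_dec_refl|]].
- apply ccont_ext_loc with q; [|exact Hq].
  exists d; split; [exact Hd|]; intros w Hw.
  replace (w - 0)%C with w in Hw by ring.
  destruct (Ceq_dec w 0) as [->|n]; [exact H2|].
  rewrite <- (H w Hw), Hf; field; exact n.
- intros z; destruct (Ceq_dec z 0) as [->|n]; [|field; exact n].
  rewrite <- H, Hf, H2 by (now rewrite Cmod_0); ring.
Qed.

Lemma jet2_of_bound (f : C -> C) (a0 a1 a2 : C) (K d : R) :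
  0 < d ->
  (forall z, Cmod z < d -> Cmod (f z - (a0 + a1 * z + a2 * (z * z))) <= K * Cmod z ^ 3) ->
  jet2 f a0 a1 a2.
Proof.
intros Hd H.
exists (fun z => if Ceq_dec z 0 then a2 else (f z - a0 - a1 * z) / (z * z))%C.
split; [|split; [apply Ceq_dec_refl|]].
- apply ccontP; rewrite Ceq_dec_refl; intros eps He.
  exists (Rmin d (eps / (Rabs K + 1))).
  assert (HK := Rabs_pos K); assert (HK' := Rle_abs K).
  split.
  { apply Rmin_pos; [exact Hd | apply Rdiv_lt_0_compat; lra]. }
  intros w Hw; replace (w - 0)%C with w in Hw by ring.
  assert (H1 : Cmod w < d) by (eapply Rlt_le_trans; [exact Hw | apply Rmin_l]).
  assert (H2 : Cmod w < eps / (Rabs K + 1)) by (eapply Rlt_le_trans; [exact Hw | apply Rmin_r]).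
  destruct (Ceq_dec w 0) as [->|n].
  { replace (a2 - a2)%C with (RtoC 0) by ring; rewrite Cmod_0; exact He. }
  assert (Hp : 0 < Cmod w) by now apply Cmod_gt_0.
  replace ((f w - a0 - a1 * w) / (w * w) - a2)%C
    with ((f w - (a0 + a1 * w + a2 * (w * w))) / (w * w))%C by (field; exact n).
  rewrite Cmod_div, Cmod_mult by (apply Cmult_neq_0; assumption).
  apply Rlt_div_l; [nra|].
  apply Rlt_div_r in H2; [|lra].
  specialize (H w H1).
  assert (Cmod w * (Rabs K + 1) * (Cmod w * Cmod w) < eps * (Cmod w * Cmod w))
    by (apply Rmult_lt_compat_r; nra).
  assert (K * Cmod w ^ 3 <= Rabs K * Cmod w ^ 3).
  { apply Rmult_le_compat_r; [apply pow_le; lra | exact HK']. }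
  assert (0 < Cmod w ^ 3) by now apply pow_lt.
  simpl in *; nra.
- intros z; destruct (Ceq_dec z 0) as [->|n]; [|field; exact n].
  specialize (H 0); rewrite Cmod_0 in H; specialize (H Hd).
  assert (E : (f 0 - (a0 + a1 * 0 + a2 * (0 * 0)))%C = 0).
  { apply Cmod_eq_0; assert (HH := Cmod_ge_0 (f 0 - (a0 + a1 * 0 + a2 * (0 * 0)))%C). simpl in H; lra. }
  replace (f 0) with ((f 0 - (a0 + a1 * 0 + a2 * (0 * 0))) + a0)%C by ring.
  rewrite E; ring.
Qed.

(** This is how a factor [z] is cancelled from an identity: divide where [z] is not 0, then pass to
    the value at 0 by continuity. *)
Lemma ccont_unique (f g : C -> C) :
  ccont f 0 -> ccont g 0 ->
  (exists d, 0 < d /\ forall z, Cmod z < d -> z <> 0 -> f z = g z) -> f 0 = g 0.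
Proof.
intros Hf Hg [d [Hd H]].
destruct (Ceq_dec (f 0) (g 0)) as [E|n]; [exact E|exfalso].
assert (Hn : 0 < Cmod (f 0 - g 0)).
{ apply Cmod_gt_0; intro E; apply n; replace (f 0) with ((f 0 - g 0) + g 0)%C by ring.
  rewrite E; ring. }
destruct (proj1 (ccontP _ _) (ccont_minus f g 0 Hf Hg) _ Hn) as [d' [Hd' H']].
set (t := Rmin d d' / 2).
assert (Ht : 0 < t) by (unfold t; assert (0 < Rmin d d') by (now apply Rmin_pos); lra).
assert (t < d) by (unfold t; assert (Rmin d d' <= d) by apply Rmin_l; lra).
assert (t < d') by (unfold t in *; assert (Rmin d d' <= d') by apply Rmin_r; lra).
assert (HC : Cmod t = t) by (rewrite Cmod_R; apply Rabs_pos_eq; lra).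
specialize (H' t); replace (t - 0)%C with (RtoC t) in H' by ring.
rewrite HC, (H t) in H'.
- replace (g t - g t - (f 0 - g 0))%C with (- (f 0 - g 0))%C in H' by ring.
  rewrite Cmod_opp in H'; lra.
- rewrite HC; assumption.
- apply Cmod_gt_0; rewrite HC; exact Ht.
Qed.

Lemma jet2_unique (f : C -> C) (a0 a1 a2 b0 b1 b2 : C) :
  jet2 f a0 a1 a2 -> jet2 f b0 b1 b2 -> a0 = b0 /\ a1 = b1 /\ a2 = b2.
Proof.
intros [p [Hp [Ep Hf]]] [q [Hq [Eq Hg]]].
assert (E0 : a0 = b0).
{ assert (E := Hf 0); rewrite Hg in E. ring_simplify in E; now rewrite E. }
subst b0.
assert (E1 : a1 = b1).
{ transitivity (a1 + 0 * p 0)%C; [ring|]; transitivity (b1 + 0 * q 0)%C; [|ring].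
  apply (ccont_unique (fun z => a1 + z * p z)%C (fun z => b1 + z * q z)%C); [ccont_tac..|].
  exists 1; split; [lra|]; intros z _ Hz.
  replace (a1 + z * p z)%C with ((f z - a0) / z)%C by (rewrite Hf; field; exact Hz).
  rewrite Hg; field; exact Hz. }
subst b1; repeat split.
rewrite <- Ep, <- Eq; apply ccont_unique; try assumption.
exists 1; split; [lra|]; intros z _ Hz.
replace (p z) with ((f z - a0 - a1 * z) / (z * z))%C by (rewrite Hf; field; exact Hz).
rewrite Hg; field; exact Hz.
Qed.

Lemma jet2_mult (f g : C -> C) (a0 a1 a2 b0 b1 b2 : C) :
  jet2 f a0 a1 a2 -> jet2 g b0 b1 b2 ->
  jet2 (fun z => f z * g z)%C (a0 * b0) (a0 * b1 + a1 * b0) (a0 * b2 + a1 * b1 + a2 * b0).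
Proof.
intros [p [Hp [Ep Hf]]] [q [Hq [Eq Hg]]].
exists (fun z => a0 * q z + a1 * b1 + p z * b0 + z * (a1 * q z + b1 * p z) + z * z * (p z * q z))%C.
split; [ccont_tac | split].
- rewrite Ep, Eq; ring.
- intros z; rewrite Hf, Hg; ring.
Qed.

Lemma jet2_affine (f : C -> C) (c d a0 a1 a2 : C) :
  jet2 f a0 a1 a2 -> jet2 (fun z => c * f z + d)%C (c * a0 + d) (c * a1) (c * a2).
Proof.
intros [p [Hp [Ep Hf]]].
exists (fun z => c * p z)%C; split; [ccont_tac | split].
- now rewrite Ep.
- intros z; rewrite Hf; ring.
Qed.

Lemma jet2_cont (f : C -> C) (a0 a1 a2 : C) : jet2 f a0 a1 a2 -> ccont f 0 /\ f 0 = a0.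
Proof.
intros [p [Hp [Ep Hf]]]; split; [|rewrite Hf; ring].
apply ccont_ext_loc with (fun z => a0 + a1 * z + z * z * p z)%C; [|ccont_tac].
exists 1; split; [lra|]; intros; symmetry; apply Hf.
Qed.

Lemma jet2_comp (f g : C -> C) (a0 a1 a2 b1 b2 : C) :
  jet2 f a0 a1 a2 -> jet2 g 0 b1 b2 ->
  jet2 (fun z => f (g z)) a0 (a1 * b1) (a1 * b2 + a2 * (b1 * b1)).
Proof.
intros [p [Hp [Ep Hf]]] Hg'; assert (Hc := jet2_cont _ _ _ _ Hg').
destruct Hc as [Hc H0]; destruct Hg' as [q [Hq [Eq Hg]]].
exists (fun z => a1 * q z + (b1 + z * q z) * (b1 + z * q z) * p (g z))%C.
split; [|split].
- assert (ccont (fun z => p (g z)) 0) by (apply ccont_comp; [|rewrite H0]; assumption).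
  ccont_tac.
- rewrite H0, Ep, Eq; ring.
- intros z; rewrite Hf; set (pz := p (g z)); rewrite Hg; ring.
Qed.

(** * The complex exponential *)

(** By the mean value theorem a bound on the derivative gains one power of [Rabs x]. Iterating from
    a crude bound on the last derivative gives Taylor estimates, with constants that are not
    sharp. *)
Lemma bound_of_derive_bound (f f' : R -> R) (K : R) (n : nat) :
  0 <= K -> f 0 = 0 ->
  (forall t, Rabs t <= 1 -> is_derive f t (f' t)) ->
  (forall t, Rabs t <= 1 -> Rabs (f' t) <= K * Rabs t ^ n) ->
  forall x, Rabs x <= 1 -> Rabs (f x) <= K * Rabs x ^ S n.
Proof.
intros HK H0 Hd Hb x Hx.
assert (Hin : forall t, Rmin 0 x <= t <= Rmax 0 x -> Rabs t <= Rabs x).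
{ intros t Ht; unfold Rmin, Rmax in Ht; destruct (Rle_dec 0 x).
  - rewrite !Rabs_pos_eq; lra.
  - rewrite !Rabs_left1; lra. }
destruct (MVT_gen f 0 x f') as [c [Hc E]].
- intros t Ht; apply Hd; eapply Rle_trans; [apply Hin; lra | exact Hx].
- intros t Ht; apply continuity_pt_filterlim, (ex_derive_continuous (K := R_AbsRing) (V := R_NormedModule)).
  exists (f' t); apply Hd; eapply Rle_trans; [apply Hin; lra | exact Hx].
- rewrite H0, !Rminus_0_r in E; rewrite E, Rabs_mult.
  specialize (Hin c Hc); simpl.
  replace (K * (Rabs x * Rabs x ^ n)) with ((K * Rabs x ^ n) * Rabs x) by ring.
  apply Rmult_le_compat_r; [apply Rabs_pos|].
  eapply Rle_trans; [apply Hb; lra|].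
  apply Rmult_le_compat_l; [exact HK|]; apply pow_incr; split; [apply Rabs_pos | exact Hin].
Qed.

Lemma exp_taylor2 (x : R) : Rabs x <= 1 -> Rabs (exp x - (1 + x + x * x / 2)) <= 3 * Rabs x ^ 3.
Proof.
apply (bound_of_derive_bound (fun x => exp x - (1 + x + x * x / 2)) (fun x => exp x - (1 + x)));
  [lra | rewrite exp_0; field | intros; auto_derive; auto; field | ].
apply (bound_of_derive_bound (fun x => exp x - (1 + x)) (fun x => exp x - 1));
  [lra | rewrite exp_0; field | intros; auto_derive; auto; field | ].
apply (bound_of_derive_bound (fun x => exp x - 1) exp);
  [lra | rewrite exp_0; field | intros; auto_derive; auto; field | ].
intros t Ht; simpl; rewrite Rabs_pos_eq by (left; apply exp_pos).
rewrite Rmult_1_r; eapply Rle_trans; [|apply exp_le_3].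
destruct (Rle_lt_or_eq_dec t 1) as [H| ->]; [|left; now apply exp_increasing|lra].
eapply Rle_trans; [apply Rle_abs | exact Ht].
Qed.

Lemma sin_abs_le (x : R) : Rabs x <= 1 -> Rabs (sin x) <= Rabs x.
Proof.
intros Hx; rewrite <- (Rmult_1_l (Rabs x)), <- (pow_1 (Rabs x)).
revert x Hx; apply (bound_of_derive_bound sin cos);
  [lra | apply sin_0 | intros; auto_derive; auto; field | ].
intros t _; simpl; rewrite Rmult_1_r; apply Rabs_le, COS_bound.
Qed.

Lemma cos_taylor1 (x : R) : Rabs x <= 1 -> Rabs (cos x - 1) <= Rabs x ^ 2.
Proof.
intros Hx; rewrite <- (Rmult_1_l (_ ^ 2)).
revert x Hx; apply (bound_of_derive_bound (fun x => cos x - 1) (fun x => - sin x));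
  [lra | rewrite cos_0; ring | intros; auto_derive; auto; field | ].
intros t Ht; rewrite Rabs_Ropp, Rmult_1_l, pow_1; now apply sin_abs_le.
Qed.

Lemma sin_taylor2 (x : R) : Rabs x <= 1 -> Rabs (sin x - x) <= Rabs x ^ 3.
Proof.
intros Hx; rewrite <- (Rmult_1_l (_ ^ 3)).
revert x Hx; apply (bound_of_derive_bound (fun x => sin x - x) (fun x => cos x - 1));
  [lra | rewrite sin_0; ring | intros; auto_derive; auto; field | ].
intros t Ht; rewrite Rmult_1_l; now apply cos_taylor1.
Qed.

Lemma cos_taylor2 (x : R) : Rabs x <= 1 -> Rabs (cos x - (1 - x * x / 2)) <= Rabs x ^ 3.
Proof.
intros Hx; rewrite <- (Rmult_1_l (_ ^ 3)).
revert x Hx; apply (bound_of_derive_bound (fun x => cos x - (1 - x * x / 2)) (fun x => x - sin x));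
  [lra | rewrite cos_0; field | intros; auto_derive; auto; field | ].
intros t Ht; rewrite Rmult_1_l, Rabs_minus_sym.
eapply Rle_trans; [now apply sin_taylor2|].
assert (H := Rabs_pos t); simpl; nra.
Qed.

Lemma im_le_Cmod (z : C) : Rabs (Im z) <= Cmod z.
Proof. eapply Rle_trans; [|apply Rmax_Cmod]; apply Rmax_r. Qed.

Lemma Cmod_le_abs (z : C) : Cmod z <= Rabs (Re z) + Rabs (Im z).
Proof.
destruct z as [x y]; replace ((x, y) : C) with (RtoC x + Ci * RtoC y)%C
  by (apply injective_projections; simpl; ring).
eapply Rle_trans; [apply Cmod_triangle|].
rewrite Cmod_mult, Cmod_Ci, !Cmod_R; simpl.
replace (x + (0 * y - 1 * 0)) with x by ring; replace (0 + (0 * 0 + 1 * y)) with y by ring; lra.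
Qed.

Lemma Cexp_plus (z w : C) : Cexp (z + w) = (Cexp z * Cexp w)%C.
Proof.
destruct z, w; unfold Cexp; apply injective_projections; simpl;
  rewrite exp_plus, ?cos_plus, ?sin_plus; ring.
Qed.

Lemma Cmod_Cexp (z : C) : Cmod (Cexp z) = exp (Re z).
Proof.
unfold Cmod, Cexp; simpl.
replace (_ + _) with (Rsqr (exp (Re z)) * (Rsqr (sin (Im z)) + Rsqr (cos (Im z)))) by (unfold Rsqr; ring).
rewrite sin2_cos2, Rmult_1_r; apply sqrt_Rsqr; left; apply exp_pos.
Qed.

Lemma Cexp_jet2 : jet2 Cexp 1 1 (/ 2).
Proof.
(* 20 is 10 for the real part plus 10 for the imaginary part; both are generous. *)
apply jet2_of_bound with (K := 20) (d := 1); [lra|].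
intros z Hz.
assert (Hx := re_le_Cmod z); assert (Hy := im_le_Cmod z).
set (rho := Cmod z) in *; destruct z as [x y]; simpl in Hx, Hy.
assert (Hrho : 0 <= rho) by apply Cmod_ge_0.
assert (Hpx : Rabs x ^ 3 <= rho ^ 3) by (apply pow_incr; split; [apply Rabs_pos | exact Hx]).
assert (Hpy : Rabs y ^ 3 <= rho ^ 3) by (apply pow_incr; split; [apply Rabs_pos | exact Hy]).
assert (H1 := exp_taylor2 x ltac:(lra)).
assert (H2 := cos_taylor2 y ltac:(lra)).
assert (H3 := sin_taylor2 y ltac:(lra)).
set (r1 := exp x - _) in H1; set (r2 := cos y - _) in H2; set (r3 := sin y - y) in H3.
assert (Hex : exp x = 1 + x + x * x / 2 + r1) by (unfold r1; ring).
assert (Hcy : cos y = 1 - y * y / 2 + r2) by (unfold r2; ring).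
assert (Hsy : sin y = y + r3) by (unfold r3; ring).
assert (Ce : Rabs (cos y) <= 1) by apply Rabs_le, COS_bound.
assert (Se : Rabs (sin y) <= 1) by apply Rabs_le, SIN_bound.
eapply Rle_trans; [apply Cmod_le_abs|].
replace (Re _) with (r1 * cos y + (1 + x + x * x / 2) * r2 - x * (y * y) / 2 - (x * x) * (y * y) / 4)
  by (unfold Cexp; simpl; rewrite Hex, Hcy; field).
replace (Im _) with (r1 * sin y + (1 + x + x * x / 2) * r3 + x * x * y / 2)
  by (unfold Cexp; simpl; rewrite Hex, Hsy; field).
assert (Ha : Rabs (1 + x + x * x / 2) <= 3).
{ apply Rabs_le_between in Hx; apply Rabs_le; nra. }
assert (B1 : Rabs (r1 * cos y) <= 3 * rho ^ 3).
{ rewrite Rabs_mult; assert (Q := Rabs_pos r1); assert (Q' := Rabs_pos (cos y)); nra. }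
assert (B2 : Rabs (r1 * sin y) <= 3 * rho ^ 3).
{ rewrite Rabs_mult; assert (Q := Rabs_pos r1); assert (Q' := Rabs_pos (sin y)); nra. }
assert (B3 : Rabs ((1 + x + x * x / 2) * r2) <= 3 * rho ^ 3).
{ rewrite Rabs_mult; apply Rmult_le_compat; try apply Rabs_pos; lra. }
assert (B4 : Rabs ((1 + x + x * x / 2) * r3) <= 3 * rho ^ 3).
{ rewrite Rabs_mult; apply Rmult_le_compat; try apply Rabs_pos; lra. }
assert (M3 : forall a b c, Rabs a <= rho -> Rabs b <= rho -> Rabs c <= rho -> Rabs (a * (b * c)) <= rho ^ 3).
{ intros a b c Qa Qb Qc; rewrite !Rabs_mult; simpl; rewrite Rmult_1_r.
  apply Rmult_le_compat; try apply Rabs_pos; auto.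
  - apply Rmult_le_pos; apply Rabs_pos.
  - apply Rmult_le_compat; try apply Rabs_pos; auto. }
assert (B5 := M3 x y y Hx Hy Hy).
assert (B6 := M3 x x y Hx Hx Hy).
assert (B7 : Rabs (x * (x * (y * y))) <= rho ^ 3).
{ rewrite Rabs_mult; assert (Q := Rabs_pos x). assert (Q' := Rabs_pos (x * (y * y))). nra. }
apply Rabs_le_between in B1, B2, B3, B4, B5, B6, B7.
assert (F1 : Rabs (r1 * cos y + (1 + x + x * x / 2) * r2 - x * (y * y) / 2 - x * x * (y * y) / 4) <= 10 * rho ^ 3)
  by (apply Rabs_le; lra).
assert (F2 : Rabs (r1 * sin y + (1 + x + x * x / 2) * r3 + x * x * y / 2) <= 10 * rho ^ 3)
  by (apply Rabs_le; lra).
lra.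
Qed.

(** The functional equation transports the expansion at 0 to any point. *)
Lemma cdiff_Cexp (z : C) : cdiff Cexp z.
Proof.
destruct Cexp_jet2 as [q [Hq [_ H]]].
exists (fun w => Cexp z * (1 + (w - z) * q (w - z)))%C; split.
- apply ccont_mult; [apply ccont_const|]; apply ccont_plus; [apply ccont_const|].
  apply ccont_mult; [ccont_tac|].
  apply (ccont_comp (fun w => w - z)%C q); [ccont_tac|].
  now replace (z - z)%C with (RtoC 0) by ring.
- intros w; replace w with (z + (w - z))%C at 1 by ring.
  rewrite Cexp_plus, (H (w - z)%C); ring.
Qed.

(** * Goursat's theorem and Schwarz functions *)

(* Imaginary part of the integral of v dw around the rectangle. *)
Definition boundary_im (v : C -> C) (s1 s2 t1 t2 : R) : R :=
  RInt (fun x => Im (v (x, t1))) s1 s2 + RInt (fun y => Re (v (s2, y))) t1 t2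
  - RInt (fun x => Im (v (x, t2))) s1 s2 - RInt (fun y => Re (v (s1, y))) t1 t2.

Lemma Re_continuous_vert (v : C -> C) (s y : R) :
  ccont v (s, y) -> continuous (fun y => Re (v (s, y))) y.
Proof.
intros H; apply filterlim_locally; intros eps.
destruct (proj1 (ccontP v _) H eps (cond_pos eps)) as [d [Hd Hw]].
exists (mkposreal d Hd); intros t Ht.
change (Rabs (Re (v (s, t)) - Re (v (s, y))) < eps).
replace (_ - _) with (Re (v (s, t) - v (s, y))%C) by reflexivity.
eapply Rle_lt_trans; [apply re_le_Cmod | apply Hw].
replace ((s, t) - (s, y))%C with (Ci * RtoC (t - y))%C
  by (apply injective_projections; simpl; ring).
rewrite Cmod_mult, Cmod_Ci, Cmod_R, Rmult_1_l; exact Ht.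
Qed.

Lemma Im_continuous_horiz (v : C -> C) (x t : R) :
  ccont v (x, t) -> continuous (fun x => Im (v (x, t))) x.
Proof.
intros H; apply filterlim_locally; intros eps.
destruct (proj1 (ccontP v _) H eps (cond_pos eps)) as [d [Hd Hw]].
exists (mkposreal d Hd); intros s Hs.
change (Rabs (Im (v (s, t)) - Im (v (x, t))) < eps).
replace (_ - _) with (Im (v (s, t) - v (x, t))%C) by reflexivity.
eapply Rle_lt_trans; [apply im_le_Cmod | apply Hw].
replace ((s, t) - (x, t))%C with (RtoC (s - x))%C
  by (apply injective_projections; simpl; ring).
rewrite Cmod_R; exact Hs.
Qed.

Definition on_rect (P : C -> Prop) (s1 s2 t1 t2 : R) : Prop :=
  forall x y, s1 <= x <= s2 -> t1 <= y <= t2 -> P (x, y).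

Lemma ex_RInt_horiz (v : C -> C) (a b t : R) :
  a <= b -> (forall x, a <= x <= b -> ccont v (x, t)) ->
  ex_RInt (fun x => Im (v (x, t))) a b.
Proof.
intros Hab H; apply (ex_RInt_continuous (V := R_CompleteNormedModule)).
intros x; rewrite Rmin_left, Rmax_right by lra; intros Hx.
now apply Im_continuous_horiz, H.
Qed.

Lemma ex_RInt_vert (v : C -> C) (s a b : R) :
  a <= b -> (forall y, a <= y <= b -> ccont v (s, y)) ->
  ex_RInt (fun y => Re (v (s, y))) a b.
Proof.
intros Hab H; apply (ex_RInt_continuous (V := R_CompleteNormedModule)).
intros x; rewrite Rmin_left, Rmax_right by lra; intros Hx.
now apply Re_continuous_vert, H.
Qed.

Lemma boundary_im_split_x (v : C -> C) (s1 s2 s3 t1 t2 : R) :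
  s1 <= s2 <= s3 -> t1 <= t2 -> on_rect (ccont v) s1 s3 t1 t2 ->
  boundary_im v s1 s3 t1 t2 = boundary_im v s1 s2 t1 t2 + boundary_im v s2 s3 t1 t2.
Proof.
intros Hs Ht H; unfold boundary_im.
rewrite <- (RInt_Chasles (fun x => Im (v (x, t1))) s1 s2 s3);
  [|apply ex_RInt_horiz; intros; try apply H; lra..].
rewrite <- (RInt_Chasles (fun x => Im (v (x, t2))) s1 s2 s3);
  [|apply ex_RInt_horiz; intros; try apply H; lra..].
unfold plus; simpl; ring.
Qed.

Lemma boundary_im_split_y (v : C -> C) (s1 s2 t1 t2 t3 : R) :
  s1 <= s2 -> t1 <= t2 <= t3 -> on_rect (ccont v) s1 s2 t1 t3 ->
  boundary_im v s1 s2 t1 t3 = boundary_im v s1 s2 t1 t2 + boundary_im v s1 s2 t2 t3.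
Proof.
intros Hs Ht H; unfold boundary_im.
rewrite <- (RInt_Chasles (fun y => Re (v (s1, y))) t1 t2 t3);
  [|apply ex_RInt_vert; intros; try apply H; lra..].
rewrite <- (RInt_Chasles (fun y => Re (v (s2, y))) t1 t2 t3);
  [|apply ex_RInt_vert; intros; try apply H; lra..].
unfold plus; simpl; ring.
Qed.

Lemma RInt_affine (A B a b : R) :
  RInt (fun x => A + B * x) a b = A * (b - a) + B * (b * b - a * a) / 2.
Proof.
apply is_RInt_unique.
replace (A * (b - a) + B * (b * b - a * a) / 2)
  with (minus (A * b + B * (b * b) / 2) (A * a + B * (a * a) / 2))
  by (unfold minus, plus, opp; simpl; field).
apply (is_RInt_derive (fun x => A * x + B * (x * x) / 2) (fun x => A + B * x)).
- intros x _; auto_derive; auto; field.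
- intros x _; apply (ex_derive_continuous (K := R_AbsRing) (V := R_NormedModule)); auto_derive; auto.
Qed.

Lemma boundary_im_affine (al be : C) (s1 s2 t1 t2 : R) :
  boundary_im (fun w => al + be * w)%C s1 s2 t1 t2 = 0.
Proof.
destruct al as [a1 a2], be as [b1 b2]; unfold boundary_im.
rewrite (RInt_ext _ (fun x => (a2 + b1 * t1) + b2 * x)) by (intros; simpl; ring).
rewrite (RInt_ext (fun y => Re _) (fun y => (a1 + b1 * s2) + - b2 * y)) by (intros; simpl; ring).
rewrite (RInt_ext (fun x => Im ((a1, a2) + (b1, b2) * (x, t2))%C) (fun x => (a2 + b1 * t2) + b2 * x)) by (intros; simpl; ring).
rewrite (RInt_ext (fun y => Re ((a1, a2) + (b1, b2) * (s1, y))%C) (fun y => (a1 + b1 * s1) + - b2 * y)) by (intros; simpl; ring).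
rewrite !RInt_affine; field.
Qed.

Lemma RInt_diff_bound (f g : R -> R) (a b M : R) :
  a <= b -> ex_RInt f a b -> ex_RInt g a b ->
  (forall t, a <= t <= b -> Rabs (f t - g t) <= M) ->
  Rabs (RInt f a b - RInt g a b) <= (b - a) * M.
Proof.
intros Hab Hf Hg H.
replace (RInt f a b - RInt g a b) with (RInt (fun t => minus (f t) (g t)) a b)
  by (apply (RInt_minus (V := R_CompleteNormedModule)); assumption).
apply abs_RInt_le_const; auto.
now apply (ex_RInt_minus (V := R_NormedModule)).
Qed.

Lemma boundary_im_diff (v w : C -> C) (s1 s2 t1 t2 M : R) :
  s1 <= s2 -> t1 <= t2 ->
  on_rect (ccont v) s1 s2 t1 t2 -> on_rect (ccont w) s1 s2 t1 t2 ->
  on_rect (fun z => Cmod (v z - w z) <= M) s1 s2 t1 t2 ->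
  Rabs (boundary_im v s1 s2 t1 t2 - boundary_im w s1 s2 t1 t2)
    <= 2 * ((s2 - s1) + (t2 - t1)) * M.
Proof.
intros Hs Ht Hv Hw H; unfold boundary_im.
assert (Hh : forall t, t1 <= t <= t2 ->
  Rabs (RInt (fun x => Im (v (x, t))) s1 s2 - RInt (fun x => Im (w (x, t))) s1 s2) <= (s2 - s1) * M).
{ intros t H1; apply RInt_diff_bound; [exact Hs | apply ex_RInt_horiz; auto.. |].
  intros x Hx; change (Rabs (Im (v (x, t) - w (x, t))%C) <= M).
  eapply Rle_trans; [apply im_le_Cmod | now apply H]. }
assert (Hk : forall s, s1 <= s <= s2 ->
  Rabs (RInt (fun y => Re (v (s, y))) t1 t2 - RInt (fun y => Re (w (s, y))) t1 t2) <= (t2 - t1) * M).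
{ intros s H1; apply RInt_diff_bound; [exact Ht | apply ex_RInt_vert; auto.. |].
  intros y Hy; change (Rabs (Re (v (s, y) - w (s, y))%C) <= M).
  eapply Rle_trans; [apply re_le_Cmod | now apply H]. }
assert (A1 := Hh t1 ltac:(lra)); assert (A2 := Hh t2 ltac:(lra)).
assert (A3 := Hk s1 ltac:(lra)); assert (A4 := Hk s2 ltac:(lra)).
apply Rabs_le_between in A1, A2, A3, A4; apply Rabs_le; lra.
Qed.

(** The tangent affine function has zero boundary integral. With half-perimeter [l], the difference
    from it is at most [eps / 2 * l] on the rectangle and is integrated over length [2 * l]. *)
Lemma boundary_im_local (v : C -> C) (w0 : C) (eps : R) :
  0 < eps -> cdiff v w0 ->
  exists d, 0 < d /\
    forall s1 s2 t1 t2, s1 <= Re w0 <= s2 -> t1 <= Im w0 <= t2 ->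
      (s2 - s1) + (t2 - t1) < d -> on_rect (ccont v) s1 s2 t1 t2 ->
      Rabs (boundary_im v s1 s2 t1 t2) <= eps * ((s2 - s1) + (t2 - t1)) ^ 2.
Proof.
intros He [q [Hq Hv]].
destruct (proj1 (ccontP q w0) Hq (eps / 2)) as [d [Hd H]]; [lra|].
exists d; split; [exact Hd|]; intros s1 s2 t1 t2 Hs Ht Hst Hc.
set (l := (s2 - s1) + (t2 - t1)) in *.
assert (E := boundary_im_affine (v w0 - w0 * q w0)%C (q w0) s1 s2 t1 t2).
assert (D := boundary_im_diff v (fun w => v w0 - w0 * q w0 + q w0 * w)%C s1 s2 t1 t2 (eps / 2 * l)
  ltac:(lra) ltac:(lra) Hc).
rewrite E, Rminus_0_r in D; fold l in D.
replace (eps * l ^ 2) with (2 * l * (eps / 2 * l)) by field; apply D.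
- intros x y _ _; ccont_tac.
- intros x y Hx Hy.
  replace (v (x, y) - (v w0 - w0 * q w0 + q w0 * (x, y)))%C
    with (((x, y) - w0) * (q (x, y) - q w0))%C by (rewrite (Hv (x, y)); ring).
  assert (Hl : Cmod ((x, y) - w0) <= l).
  { eapply Rle_trans; [apply Cmod_le_abs|]; destruct w0 as [x0 y0]; simpl in *.
    apply Rplus_le_compat; apply Rabs_le; lra. }
  rewrite Cmod_mult, Rmult_comm; apply Rmult_le_compat; try apply Cmod_ge_0; auto.
  left; apply H; lra.
Qed.

Lemma nested_intervals (x l : nat -> R) :
  (forall n, 0 <= l n) ->
  (forall n, x n <= x (S n) /\ x (S n) + l (S n) <= x n + l n) ->
  exists X, forall n, x n <= X <= x n + l n.
Proof.
intros Hl H.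
assert (Hm : forall n k, x n <= x (n + k)%nat /\ x (n + k)%nat + l (n + k)%nat <= x n + l n).
{ intros n k; induction k as [|k IH].
  - rewrite Nat.add_0_r; lra.
  - rewrite Nat.add_succ_r; specialize (H (n + k)%nat); lra. }
assert (Hu : forall m n, x m <= x n + l n).
{ intros m n; destruct (Nat.le_ge_cases m n) as [h|h].
  - assert (A := Hm m (n - m)%nat); replace (m + (n - m))%nat with n in A by lia.
    specialize (Hl n); lra.
  - assert (A := Hm n (m - n)%nat); replace (n + (m - n))%nat with m in A by lia.
    specialize (Hl m); lra. }
destruct (completeness (fun y => exists n, y = x n)) as [X [HX1 HX2]].
- exists (x O + l O); intros y [n ->]; apply Hu.
- now exists (x O), O.
- exists X; intros n; split.
  + apply HX1; now exists n.
  + apply HX2; intros y [m ->]; apply Hu.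
Qed.

(** Integrals over inner sides cancel, so the four quarters add up to the whole and one of them
    carries at least a quarter of the modulus. *)
Lemma goursat_quarter (v : C -> C) (x y a b M : R) :
  0 <= a -> 0 <= b ->
  on_rect (ccont v) x (x + a) y (y + b) ->
  M <= Rabs (boundary_im v x (x + a) y (y + b)) ->
  exists x' y', (x <= x' /\ x' + a / 2 <= x + a) /\ (y <= y' /\ y' + b / 2 <= y + b) /\
    M / 4 <= Rabs (boundary_im v x' (x' + a / 2) y' (y' + b / 2)).
Proof.
intros Ha Hb Hc HM.
assert (E : boundary_im v x (x + a) y (y + b) =
  boundary_im v x (x + a / 2) y (y + b / 2)
  + boundary_im v (x + a / 2) (x + a / 2 + a / 2) y (y + b / 2)
  + boundary_im v x (x + a / 2) (y + b / 2) (y + b / 2 + b / 2)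
  + boundary_im v (x + a / 2) (x + a / 2 + a / 2) (y + b / 2) (y + b / 2 + b / 2)).
{ replace (x + a / 2 + a / 2) with (x + a) by field.
  replace (y + b / 2 + b / 2) with (y + b) by field.
  rewrite (boundary_im_split_y v x (x + a) y (y + b / 2) (y + b)) by (auto; lra).
  rewrite !(boundary_im_split_x v x (x + a / 2) (x + a));
    try lra; intros s t Hs Ht; apply Hc; lra. }
rewrite E in HM; clear E.
match type of HM with _ <= Rabs (?p + ?q + ?r + ?s) =>
  assert (T : Rabs (p + q + r + s) <= Rabs p + Rabs q + Rabs r + Rabs s)
    by (eapply Rle_trans; [apply Rabs_triang|]; apply Rplus_le_compat_r;
        eapply Rle_trans; [apply Rabs_triang|]; apply Rplus_le_compat_r; apply Rabs_triang);
  destruct (Rle_dec (M / 4) (Rabs p)); [exists x, y; repeat split; lra|];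
  destruct (Rle_dec (M / 4) (Rabs q)); [exists (x + a / 2), y; repeat split; lra|];
  destruct (Rle_dec (M / 4) (Rabs r)); [exists x, (y + b / 2); repeat split; lra|];
  exists (x + a / 2), (y + b / 2); repeat split; lra
end.
Qed.

Lemma goursat (v : C -> C) (s1 s2 t1 t2 : R) :
  s1 <= s2 -> t1 <= t2 -> on_rect (cdiff v) s1 s2 t1 t2 ->
  boundary_im v s1 s2 t1 t2 = 0.
Proof.
intros Hs Ht Hv.
destruct (Req_dec (boundary_im v s1 s2 t1 t2) 0) as [E|Hne]; [exact E|exfalso].
set (M := Rabs (boundary_im v s1 s2 t1 t2)).
assert (HM : 0 < M) by now apply Rabs_pos_lt.
pose (l n := (/ 2) ^ n); pose (a n := (s2 - s1) * l n); pose (b n := (t2 - t1) * l n).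
assert (Hl : forall n, 0 < l n) by (intros n; apply pow_lt; lra).
assert (Hls : forall n, l (S n) = l n / 2) by (intros n; unfold l; simpl; field).
assert (Has : forall n, a (S n) = a n / 2) by (intros n; unfold a; rewrite Hls; field).
assert (Hbs : forall n, b (S n) = b n / 2) by (intros n; unfold b; rewrite Hls; field).
assert (Ha : forall n, 0 <= a n) by (intros n; specialize (Hl n); unfold a; nra).
assert (Hb : forall n, 0 <= b n) by (intros n; specialize (Hl n); unfold b; nra).
assert (Hv' : on_rect (ccont v) s1 s2 t1 t2)
  by (intros x y Hx Hy; now apply cdiff_cont, Hv).
pose (inv n (p : R * R) :=
  (s1 <= fst p /\ fst p + a n <= s2) /\ (t1 <= snd p /\ snd p + b n <= t2) /\
  M * (l n * l n) <= Rabs (boundary_im v (fst p) (fst p + a n) (snd p) (snd p + b n))).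
(* The invariant is a premise inside the existential, so that choice yields a total function on
   pairs that can be iterated. *)
assert (step : forall n p, exists p', inv n p -> inv (S n) p' /\
  (fst p <= fst p' /\ fst p' + a (S n) <= fst p + a n) /\
  (snd p <= snd p' /\ snd p' + b (S n) <= snd p + b n)).
{ intros n p; destruct (classic (inv n p)) as [[H1 [H2 H3]]|Hn]; [|exists p; tauto].
  destruct (goursat_quarter v (fst p) (snd p) (a n) (b n) (M * (l n * l n)) (Ha n) (Hb n)) with (2 := H3)
    as [x' [y' [Hx [Hy HQ]]]].
  { intros x y Hx Hy; apply Hv'; lra. }
  exists (x', y'); intros _; unfold inv; simpl; rewrite Has, Hbs, Hls.
  repeat split; lra. }
pose (next n p := proj1_sig (constructive_indefinite_description _ (step n p))).
pose (sq := nat_rect (fun _ => (R * R)%type) (s1, t1) next).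
assert (Hsq : forall n, inv n (sq n)).
{ induction n as [|n IH].
  - unfold inv, a, b, l; simpl; repeat split; try lra.
    replace (s1 + (s2 - s1) * 1) with s2 by ring; replace (t1 + (t2 - t1) * 1) with t2 by ring.
    fold M; lra.
  - exact (proj1 (proj2_sig (constructive_indefinite_description _ (step n (sq n))) IH)). }
assert (Hnx := fun n => proj2 (proj2_sig (constructive_indefinite_description _ (step n (sq n))) (Hsq n))).
destruct (nested_intervals (fun n => fst (sq n)) a Ha (fun n => proj1 (Hnx n))) as [X HX].
destruct (nested_intervals (fun n => snd (sq n)) b Hb (fun n => proj2 (Hnx n))) as [Y HY].
assert (HXY : cdiff v (X, Y)).
{ destruct (Hsq O) as [H1 [H2 _]]; specialize (HX O); specialize (HY O); apply Hv; lra. }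
set (L := (s2 - s1) + (t2 - t1)).
assert (HL : 0 <= L) by (unfold L; lra).
assert (HL2 : 0 <= L ^ 2) by now apply pow_le.
(* With this [eps] the local estimate at scale [l N] is below half of the lower bound
   [M * (l N * l N)]. The added 1 keeps the denominators positive when the rectangle is a point. *)
destruct (boundary_im_local v (X, Y) (M / (2 * (L ^ 2 + 1)))) as [d [Hd Hloc]]; auto.
{ apply Rdiv_lt_0_compat; lra. }
destruct (pow_lt_1_zero (/ 2)) with (y := d / (L + 1)) as [N HN].
{ rewrite Rabs_pos_eq; lra. }
{ apply Rdiv_lt_0_compat; lra. }
specialize (HN N (Nat.le_refl N)); fold (l N) in HN.
rewrite Rabs_pos_eq in HN by (left; apply Hl).
apply Rlt_div_r in HN; [|lra].
destruct (Hsq N) as [H1 [H2 H3]]; specialize (HX N); specialize (HY N); specialize (Hl N).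
assert (HaN : a N + b N = l N * L) by (unfold a, b, L; ring).
specialize (Hloc (fst (sq N)) (fst (sq N) + a N) (snd (sq N)) (snd (sq N) + b N)).
replace (_ - _ + _) with (l N * L) in Hloc by (rewrite <- HaN; ring).
assert (Hf : M * (l N * l N) <= M / (2 * (L ^ 2 + 1)) * (l N * L) ^ 2).
{ eapply Rle_trans; [exact H3|]; apply Hloc; simpl; try lra.
  intros x y Hx Hy; apply Hv'; lra. }
replace (M / (2 * (L ^ 2 + 1)) * (l N * L) ^ 2)
  with ((M * (l N * l N)) * (L ^ 2 / (2 * (L ^ 2 + 1)))) in Hf by (field; lra).
assert (HP : 0 < M * (l N * l N)) by (repeat apply Rmult_lt_0_compat; assumption).
assert (L ^ 2 / (2 * (L ^ 2 + 1)) < 1) by (apply Rlt_div_l; lra).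
nra.
Qed.

(* With z = exp w, the circles |z| = const become the vertical sides of a
   period rectangle, and the two horizontal sides cancel by periodicity. *)
Lemma center_max_principle (K : C -> C) (r M : R) :
  0 < r < 1 ->
  (forall z : C, z <> 0 -> unit_disk z -> cdiff K z) -> ccont K 0 ->
  (forall z, Cmod z = r -> Re (K z) <= M) -> Re (K 0) <= M.
Proof.
intros Hr HK H0 HM.
destruct (Rle_dec (Re (K 0)) M) as [h|Hn]; [exact h|exfalso].
set (eta := (Re (K 0) - M) / 2).
(* Continuity at 0 alone controls small circles: there [Re (K z)] exceeds [M + eta]. Hence [K] may
   be a quotient such as [u z / z], not known to be differentiable at 0. *)
destruct (proj1 (ccontP K 0) H0 eta) as [d [Hd Hc]]; [unfold eta; lra|].
assert (HPI := PI_RGT_0).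
(* The right side is the circle of radius [r]; the left one a circle inside both radii [r] and
   [d]. *)
pose (s2 := ln r); pose (s1 := Rmin (ln r) (ln d) - 1).
assert (Hs : s1 <= s2) by (unfold s1, s2; assert (A := Rmin_l (ln r) (ln d)); lra).
assert (Hcd : forall x y, x <= s2 -> cdiff (fun w => K (Cexp w)) (x, y)).
{ intros x y Hx; apply cdiff_comp; [apply cdiff_Cexp|].
  apply HK; [apply Cmod_gt_0; rewrite Cmod_Cexp; apply exp_pos|].
  unfold unit_disk; rewrite Cmod_Cexp; simpl.
  apply Rle_lt_trans with (exp s2); [|unfold s2; rewrite exp_ln; lra].
  destruct Hx as [Hx| ->]; [left; now apply exp_increasing | lra]. }
assert (G := goursat (fun w => K (Cexp w)) s1 s2 0 (2 * PI) Hs ltac:(lra)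
  (fun x y Hx _ => Hcd x y (proj2 Hx))).
unfold boundary_im in G.
rewrite (RInt_ext (fun x => Im (K (Cexp (x, 2 * PI)))) (fun x => Im (K (Cexp (x, 0))))) in G.
2:{ intros x _; unfold Cexp; simpl; now rewrite cos_2PI, sin_2PI, cos_0, sin_0. }
assert (E : RInt (fun y => Re (K (Cexp (s2, y)))) 0 (2 * PI) = RInt (fun y => Re (K (Cexp (s1, y)))) 0 (2 * PI)) by lra.
assert (Hex : forall s, s <= s2 -> ex_RInt (fun y => Re (K (Cexp (s, y)))) 0 (2 * PI)).
{ intros s H; apply (ex_RInt_vert (fun w => K (Cexp w))); [lra|].
  intros y _; now apply cdiff_cont, Hcd. }
assert (U : RInt (fun y => Re (K (Cexp (s2, y)))) 0 (2 * PI) <= RInt (fun _ => M) 0 (2 * PI)).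
{ apply RInt_le; [lra | apply Hex; lra | apply ex_RInt_const|].
  intros y _; apply HM; rewrite Cmod_Cexp; simpl; apply exp_ln; lra. }
assert (V : RInt (fun _ => M + eta) 0 (2 * PI) <= RInt (fun y => Re (K (Cexp (s1, y)))) 0 (2 * PI)).
{ apply RInt_le; [lra | apply ex_RInt_const | now apply Hex |].
  intros y _.
  assert (Cmod (K (Cexp (s1, y)) - K 0) < eta).
  { apply Hc; replace (Cexp (s1, y) - 0)%C with (Cexp (s1, y)) by ring.
    rewrite Cmod_Cexp; simpl; rewrite <- (exp_ln d Hd); apply exp_increasing.
    unfold s1; assert (A := Rmin_r (ln r) (ln d)); lra. }
  assert (A := re_le_Cmod (K (Cexp (s1, y)) - K 0)).
  change (Re (K (Cexp (s1, y)) - K 0)%C) with (Re (K (Cexp (s1, y))) - Re (K 0)) in A.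
  apply Rabs_le_between in A; unfold eta in *; lra. }
rewrite RInt_const in U, V; unfold scal in U, V; simpl in U, V; unfold mult in U, V; simpl in U, V.
unfold eta in V; nra.
Qed.

(** * Coefficient inequalities for Schwarz functions *)

Lemma unit_phase (b : C) : exists t : C, (Cconj t * t)%C = 1 /\ (Cconj t * b)%C = RtoC (Cmod b).
Proof.
destruct (Ceq_dec b 0) as [->|n].
- exists 1; rewrite Cmod_0; split; apply injective_projections; simpl; ring.
- exists (b / Cmod b)%C.
  assert (Hb : 0 < Cmod b) by now apply Cmod_gt_0.
  assert (Hb' : RtoC (Cmod b) <> 0) by (intro E; injection E; lra).
  assert (E : (Cconj b * b)%C = (Cmod b * Cmod b)%C).
  { rewrite Cmult_comm, <- Cmod2_conj, <- RtoC_mult; f_equal; ring. }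
  assert (Hc : Cconj (b / Cmod b)%C = (Cconj b / Cmod b)%C).
  { rewrite Cdiv_conj by exact Hb'; f_equal; f_equal; apply injective_projections; simpl; ring. }
  rewrite Hc; split.
  + replace (Cconj b / Cmod b * (b / Cmod b))%C with ((Cconj b * b) / (Cmod b * Cmod b))%C
      by (field; exact Hb').
    rewrite E; field; exact Hb'.
  + replace (Cconj b / Cmod b * b)%C with ((Cconj b * b) / Cmod b)%C by (field; exact Hb').
    rewrite E; field; exact Hb'.
Qed.

Definition schwarz_function (u : C -> C) : Prop :=
  analytic u /\ u 0 = 0 /\ forall z, unit_disk z -> Cmod (u z) < 1.

Lemma cdiff_ext_loc (f g : C -> C) (z : C) :
  (exists d, 0 < d /\ forall w, Cmod (w - z) < d -> f w = g w) ->
  cdiff f z -> cdiff g z.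
Proof.
intros Hfg [q [Hq Hf]]; assert (Hz : f z = g z).
{ destruct Hfg as [d [Hd H]]; apply H; replace (z - z)%C with (RtoC 0) by ring; now rewrite Cmod_0. }
exists (fun w => if Ceq_dec w z then q z else (g w - g z) / (w - z))%C; split.
- apply ccont_ext_loc with q; [|exact Hq].
  destruct Hfg as [d [Hd H]]; exists d; split; [exact Hd|]; intros w Hw.
  destruct (Ceq_dec w z) as [->|n]; [reflexivity|].
  rewrite <- (H w Hw), <- Hz, Hf; field; now apply Cminus_eq_contra.
- intros w; destruct (Ceq_dec w z) as [->|n]; [ring|].
  field; now apply Cminus_eq_contra.
Qed.

Lemma cdiff_quotient (f k : C -> C) (z : C) :
  (forall w, f w = w * k w)%C -> z <> 0 -> cdiff f z -> cdiff k z.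
Proof.
intros H Hz Hf; apply cdiff_ext_loc with (fun w => / w * f w)%C.
- exists (Cmod z); split; [now apply Cmod_gt_0|]; intros w Hw.
  destruct (Ceq_dec w 0) as [->|n].
  + exfalso; replace (0 - z)%C with (- z)%C in Hw by ring; rewrite Cmod_opp in Hw; lra.
  + rewrite H; field; exact n.
- apply cdiff_mult; [now apply cdiff_inv | exact Hf].
Qed.

Lemma Re_le_Cmod (z : C) : Re z <= Cmod z.
Proof. eapply Rle_trans; [apply Rle_abs | apply re_le_Cmod]. Qed.

(** Replaces the limit r -> 1. Two factors [r] are allowed: in the second-order inequality one comes
    from the bound [/ r] on u(z)/z, the other from the weight [r] on the second coefficient. *)
Lemma le_of_scaled_le (x y : R) :
  0 <= y -> (forall r, 0 < r < 1 -> r * r * x <= y) -> x <= y.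
Proof.
intros Hy H; destruct (Rle_dec x y) as [h|n]; [exact h|exfalso].
assert (Hx : 0 < x) by lra.
(* With [r = 1 - d], [r * r * x] exceeds [x - 2 * d * x = (x + y) / 2], which is above [y]. *)
set (d := (x - y) / (4 * x)).
assert (Q : 0 < d) by (apply Rdiv_lt_0_compat; lra).
assert (Q1 : d < 1) by (apply Rlt_div_l; lra).
assert (Q2 : d * x = (x - y) / 4) by (unfold d; field; lra).
specialize (H (1 - d) ltac:(lra)); nra.
Qed.

Lemma Cmod_unit (t : C) : (Cconj t * t)%C = 1 -> Cmod t = 1.
Proof.
intros H; assert (A : Cmod (Cconj t * t) = 1) by (rewrite H; apply Cmod_1).
rewrite Cmod_mult, Cmod_conj in A; assert (B := Cmod_ge_0 t); nra.
Qed.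

(** Schwarz's lemma at the origin: [k] is bounded by [/ r] on the circle of radius [r], and a
    rotation by [Cconj t] turns the modulus of [k 0] into a real part. *)
Lemma schwarz_coef1 (u k : C -> C) :
  schwarz_function u -> ccont k 0 -> (forall z, u z = z * k z)%C -> Cmod (k 0) <= 1.
Proof.
intros [Hu [_ Hb]] Hk E.
apply le_of_scaled_le; [lra|]; intros r Hr.
destruct (unit_phase (k 0)) as [t [Ht1 Ht2]].
assert (Htm : Cmod (Cconj t) = 1) by (rewrite Cmod_conj; now apply Cmod_unit).
assert (H : Re (Cconj t * k 0) <= / r).
{ apply (center_max_principle (fun z => Cconj t * k z)%C r (/ r) Hr).
  - intros z Hz Hd; apply cdiff_mult; [apply cdiff_const|].
    apply (cdiff_quotient u); auto; now apply cdiff_analytic.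
  - ccont_tac.
  - intros z Hz; eapply Rle_trans; [apply Re_le_Cmod|].
    rewrite Cmod_mult, Htm, Rmult_1_l.
    assert (A := Hb z ltac:(unfold unit_disk; lra)).
    rewrite E, Cmod_mult, Hz in A.
    apply Rmult_le_reg_l with r; [lra|]; rewrite Rinv_r; lra. }
rewrite Ht2 in H; simpl in H.
apply Rmult_le_compat_l with (r := r) in H; [|lra]; rewrite Rinv_r in H by lra.
assert (A := Cmod_ge_0 (k 0)); nra.
Qed.

(* With om = u / z and z = r e on the circle, K differs from
   om t e (conj a + conj t conj e)^2 only by terms of mean zero, which remove
   the pole at 0 and make the bound on Re K constant. *)
Lemma schwarz_coef2 (u : C -> C) (a b : C) :
  schwarz_function u -> jet2 u 0 a b -> Cmod b + Cmod a ^ 2 <= 1.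
Proof.
intros [Hu [_ Hb]] [q [Hq [Eq E]]].
destruct (unit_phase b) as [t [Ht1 Ht2]].
assert (Htm := Cmod_unit t Ht1).
assert (Ha2 : 0 <= Cmod a ^ 2) by apply pow2_ge_0.
(* The left side is now the real part of [Cconj t * b + 2 * Cconj a * a], linear in the coefficients
   of [u]; the right side is the mean of the squared modulus of [conj a + conj t conj e]. *)
cut (Cmod b + 2 * Cmod a ^ 2 <= 1 + Cmod a ^ 2); [lra|].
apply le_of_scaled_le; [lra|]; intros r Hr.
assert (Hr0 : RtoC r <> 0) by (intro H; injection H; lra).
pose (om z := (a + z * q z)%C).
assert (Eom : forall z, u z = (z * om z)%C) by (intros z; rewrite E; unfold om; ring).
assert (Hom : forall z : C, z <> 0 -> unit_disk z -> cdiff om z).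
{ intros z Hz Hd; apply (cdiff_quotient u); auto; now apply cdiff_analytic. }
assert (Hqd : forall z : C, z <> 0 -> unit_disk z -> cdiff q z).
{ intros z Hz Hd; apply (cdiff_quotient (fun w => om w + - a)%C); auto.
  - intros w; unfold om; ring.
  - apply cdiff_plus; [now apply Hom | apply cdiff_const]. }
(* Only the first two summands survive at 0. The factor [r] on [q] is what [1 / e] leaves of [1 / z]
   on the circle. Since [om] is bounded by [/ r], the estimate of the kernel contains
   [2 / r * Re p]; removing the pole already subtracts [Cconj p], and the last summand subtracts the
   other [2 / r - 1]. *)
pose (K z := (RtoC 2 * Cconj a * om z + Cconj t * r * q z
  + Cconj a * Cconj a * t / r * z * om z + - ((2 / r - 1) * (Cconj a * t / r) * z))%C).
assert (H : Re (K 0) <= (1 + Cmod a ^ 2) / r).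
{ apply (center_max_principle K r); [exact Hr | | |].
  - intros z Hz Hd; unfold K.
    specialize (Hom z Hz Hd); specialize (Hqd z Hz Hd).
    repeat apply cdiff_plus; try (apply cdiff_mult; [|assumption]); try apply cdiff_const.
    + apply cdiff_mult; [apply cdiff_const | apply cdiff_id].
    + destruct (cdiff_mult (fun _ => - ((2 / r - 1) * (Cconj a * t / r)))%C (fun w => w) z
        (cdiff_const _ _) (cdiff_id _)) as [k [Hk Ek]].
      exists k; split; [exact Hk|]; intros w; specialize (Ek w); simpl in Ek.
      replace (- ((2 / r - 1) * (Cconj a * t / r) * w))%C
        with (- ((2 / r - 1) * (Cconj a * t / r)) * w)%C by ring.
      rewrite Ek; ring.
  - assert (ccont om 0) by (unfold om; ccont_tac).
    unfold K; ccont_tac.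
  - intros z Hz.
    pose (e := (z / r)%C).
    assert (Ez : z = (r * e)%C) by (unfold e; field; exact Hr0).
    assert (Hem : Cmod e = 1).
    { unfold e; rewrite Cmod_div, Hz, Cmod_R, Rabs_pos_eq by (exact Hr0 || lra); field; lra. }
    assert (He1 : (Cconj e * e)%C = 1).
    { rewrite Cmult_comm, <- Cmod2_conj, Hem; f_equal; ring. }
    pose (p := (Cconj a * t * e)%C).
    assert (Ep : Cconj p = (a * Cconj t * Cconj e)%C)
      by (unfold p; rewrite !Cmult_conj, Cconj_conj; ring).
    pose (s := (Cconj a + Cconj t * Cconj e)%C).
    assert (Es : Cmod s ^ 2 = Cmod a ^ 2 + 1 + 2 * Re p).
    { assert (Q : RtoC (Cmod s ^ 2) = (RtoC (Cmod a ^ 2) + 1 + (p + Cconj p))%C).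
      { rewrite !Cmod2_conj; unfold s at 2; rewrite Cplus_conj, Cmult_conj, !Cconj_conj, Ep.
        transitivity (Cconj a * a + p + a * Cconj t * Cconj e + (Cconj t * t) * (Cconj e * e))%C;
          [unfold s, p; ring | rewrite Ht1, He1; ring]. }
      revert Q; generalize (Cmod s ^ 2) (Cmod a ^ 2) p; intros x y [w1 w2] Q.
      apply (f_equal Re) in Q; simpl in *; lra. }
    assert (EK : K z = (om z * (t * e * (s * s)) - Cconj p - (2 / r - 1) * p)%C).
    { transitivity (om z * (Cconj a * Cconj a * t * e + RtoC 2 * Cconj a * (Cconj t * t) * (Cconj e * e)
        + Cconj t * Cconj e * (Cconj t * t) * (Cconj e * e)) - Cconj p - (2 / r - 1) * p)%C;
        [|unfold s; ring].
      rewrite Ht1, He1, Ep; unfold K, p.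
      transitivity (RtoC 2 * Cconj a * om z + Cconj t * r * (Cconj e * e) * q z
        + Cconj a * Cconj a * t * e * om z - (2 / r - 1) * (Cconj a * t * e))%C.
      - rewrite He1; unfold e; field; exact Hr0.
      - unfold om; generalize (q z); intros Q; rewrite Ez; field; exact Hr0. }
    rewrite EK.
    assert (Hw : Cmod (om z) <= / r).
    { assert (A := Hb z ltac:(unfold unit_disk; lra)).
      rewrite Eom, Cmod_mult, Hz in A.
      apply Rmult_le_reg_l with r; [lra|]; rewrite Rinv_r; lra. }
    assert (A := Re_le_Cmod (om z * (t * e * (s * s)))).
    rewrite !Cmod_mult, Htm, Hem in A.
    assert (B : Cmod (om z) * Cmod s ^ 2 <= / r * Cmod s ^ 2)
      by (apply Rmult_le_compat_r; [apply pow2_ge_0 | exact Hw]).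
    assert (ER : forall x y : C, Re (x - Cconj y - (2 / r - 1) * y)%C = Re x - 2 / r * Re y).
    { intros [x1 x2] [y1 y2].
      replace (2 / r - 1)%C with (RtoC (2 / r - 1))
        by (now rewrite RtoC_minus, RtoC_div by (intro E0; apply Hr0; now rewrite E0)).
      simpl; ring. }
    rewrite ER.
    assert (B' : Cmod (om z) * (1 * 1 * (Cmod s * Cmod s)) = Cmod (om z) * Cmod s ^ 2) by ring.
    rewrite Es in B, B'; unfold Rdiv; lra. }
assert (EK0 : Re (K 0) = 2 * Cmod a ^ 2 + r * Cmod b).
{ replace (K 0) with (RtoC (2 * Cmod a ^ 2 + r * Cmod b)); [reflexivity|].
  rewrite RtoC_plus, !RtoC_mult, Cmod2_conj, <- Ht2.
  unfold K, om; rewrite Eq; ring. }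
rewrite EK0 in H.
apply Rle_div_r in H; [|lra].
assert (A := Cmod_ge_0 b); nra.
Qed.

(** * Second-order expansions *)

Lemma bounded_of_eventually (u : nat -> R) (B : R) (N : nat) :
  (forall n, (N <= n)%nat -> u n <= B) -> exists M, forall n, u n <= M.
Proof.
revert B; induction N as [|N IH]; intros B H.
- exists B; intros n; apply H; lia.
- apply (IH (Rmax B (u N))); intros n Hn.
  destruct (Nat.eq_dec n N) as [->|Hne]; [apply Rmax_r|].
  eapply Rle_trans; [apply H; lia | apply Rmax_l].
Qed.

Definition partial_sum (a : nat -> C) (z : C) (n : nat) : C :=
  sum_n (G := C_AbelianMonoid) (fun k => (pow_n (K := C_Ring) z k * a k)%C) n.

Lemma partial_sum_lim (a : nat -> C) (z l : C) :
  is_pseries (K := C_AbsRing) (V := C_NormedModule) a z l ->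
  forall eps, 0 < eps -> exists N, forall n, (N <= n)%nat -> Cmod (partial_sum a z n - l) < eps.
Proof.
intros H eps He.
destruct (proj1 (filterlim_locally_ball_norm (U := C_NormedModule) _ l) H (mkposreal eps He)) as [N HN].
exists N; exact HN.
Qed.

Lemma partial_sum_S (a : nat -> C) (z : C) (n : nat) :
  partial_sum a z (S n) = (partial_sum a z n + pow_n (K := C_Ring) z (S n) * a (S n))%C.
Proof. unfold partial_sum; now rewrite sum_Sn. Qed.

Lemma Cmod_pow_n (z : C) (n : nat) : Cmod (pow_n (K := C_Ring) z n) = Cmod z ^ n.
Proof.
induction n as [|n IH]; [apply Cmod_1|].
simpl; unfold mult; simpl; now rewrite Cmod_mult, IH.
Qed.

(** A weak Cauchy estimate without integrals: the terms of the convergent series at 1/2 are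
    differences of consecutive partial sums, eventually both within 1 of the limit. *)
Lemma pseries_coef_bound (f : C -> C) (a : nat -> C) :
  analytic_series f a -> exists M, 0 < M /\ forall n, Cmod (a n) <= M * 2 ^ n.
Proof.
intros [_ H].
assert (Hh : Cmod (/ 2)%R = / 2) by (rewrite Cmod_R; apply Rabs_pos_eq; lra).
destruct (partial_sum_lim a (RtoC (/ 2)) _ (H (RtoC (/ 2)) ltac:(unfold unit_disk; lra)) 1 Rlt_0_1) as [N HN].
destruct (bounded_of_eventually (fun n => Cmod (a n) * (/ 2) ^ n) 2 (S N)) as [M HM].
{ intros [|n] Hn; [lia|].
  rewrite <- Hh, <- Cmod_pow_n, <- Cmod_mult.
  set (h := RtoC (/ 2)) in *.
  replace (a (S n) * pow_n (K := C_Ring) h (S n))%C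
    with ((partial_sum a h (S n) - f h) + - (partial_sum a h n - f h))%C
    by (rewrite partial_sum_S; ring).
  eapply Rle_trans; [apply Cmod_triangle|]; rewrite Cmod_opp.
  assert (A := HN n ltac:(lia)); assert (B := HN (S n) ltac:(lia)); lra. }
exists (Rmax M 1); split; [assert (A := Rmax_r M 1); lra|]; intros n.
assert (P : 0 < 2 ^ n) by (apply pow_lt; lra).
assert (Q : Cmod (a n) * (/ 2) ^ n <= Rmax M 1)
  by (eapply Rle_trans; [apply HM | apply Rmax_l]).
rewrite pow_inv in Q; now apply Rle_div_l in Q.
Qed.

Lemma pow_n_lipschitz (z w : C) (rho : R) (n : nat) :
  Cmod z <= rho -> Cmod w <= rho ->
  Cmod (pow_n (K := C_Ring) z (S n) - pow_n (K := C_Ring) w (S n)) <= INR (S n) * rho ^ n * Cmod (z - w).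
Proof.
intros Hz Hw; assert (H0 := Cmod_ge_0 z); induction n as [|n IH].
- simpl; unfold mult, one; simpl; rewrite !Cmult_1_r; lra.
- replace (pow_n (K := C_Ring) z (S (S n)) - pow_n (K := C_Ring) w (S (S n)))%C
    with (z * (pow_n (K := C_Ring) z (S n) - pow_n (K := C_Ring) w (S n))
          + pow_n (K := C_Ring) w (S n) * (z - w))%C
    by (simpl; unfold mult; simpl; ring).
  eapply Rle_trans; [apply Cmod_triangle|].
  rewrite !Cmod_mult, Cmod_pow_n, (S_INR (S n)).
  assert (D := Cmod_ge_0 (z - w)).
  assert (P : Cmod w ^ S n <= rho ^ S n) by (apply pow_incr; split; [apply Cmod_ge_0 | exact Hw]).
  assert (Q : Cmod z * Cmod (pow_n (K := C_Ring) z (S n) - pow_n (K := C_Ring) w (S n))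
    <= rho * (INR (S n) * rho ^ n * Cmod (z - w)))
    by (apply Rmult_le_compat; auto using Cmod_ge_0).
  assert (T : Cmod w ^ S n * Cmod (z - w) <= rho ^ S n * Cmod (z - w))
    by now apply Rmult_le_compat_r.
  replace ((INR (S n) + 1) * rho ^ S n * Cmod (z - w))
    with (rho * (INR (S n) * rho ^ n * Cmod (z - w)) + rho ^ S n * Cmod (z - w)) by (simpl; ring).
  lra.
Qed.

Definition taylor3 (a : nat -> C) (z : C) : C :=
  (a 0%nat + a 1%nat * z + a 2%nat * (z * z) + a 3%nat * (z * z * z))%C.

Lemma INR_le_pow2 (n : nat) : INR (S n) <= 2 ^ n.
Proof.
induction n as [|n IH]; [simpl; lra|].
rewrite S_INR; assert (1 <= 2 ^ n) by (apply pow_R1_Rle; lra); simpl (2 ^ S n); lra.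
Qed.

(** The majorant is telescoping. A new term costs at most [2 * M * (4 * rho) ^ n] (growth 2 from
    [INR_le_pow2], 2 from the coefficients), and since [4 * rho <= 1 / 2] this is covered by 4 M
    times the decrease of [(4 * rho) ^ n]. *)
Lemma partial_sum_remainder (a : nat -> C) (M rho : R) (z w : C) (k : nat) :
  0 < M -> (forall n, Cmod (a n) <= M * 2 ^ n) ->
  Cmod z <= rho -> Cmod w <= rho -> rho <= / 8 ->
  Cmod ((partial_sum a z (3 + k) - taylor3 a z) - (partial_sum a w (3 + k) - taylor3 a w))
    <= 4 * M * ((4 * rho) ^ 3 - (4 * rho) ^ (3 + k)) * Cmod (z - w).
Proof.
intros HM Ha Hz Hw Hr.
assert (H0 := Cmod_ge_0 z); assert (D := Cmod_ge_0 (z - w)).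
induction k as [|k IH].
- assert (E : forall y, partial_sum a y (3 + 0) = taylor3 a y).
  { intros y; unfold partial_sum, taylor3; simpl.
    rewrite !sum_Sn, sum_O; simpl; unfold plus, mult, one; simpl; ring. }
  rewrite !E; replace (_ - _)%C with (RtoC 0) by ring; rewrite Cmod_0; simpl; lra.
- replace (3 + S k)%nat with (S (3 + k)) by lia; rewrite !partial_sum_S.
  set (n := (3 + k)%nat) in *; clearbody n.
  replace (_ - _)%C with (((partial_sum a z n - taylor3 a z) - (partial_sum a w n - taylor3 a w))
    + (pow_n (K := C_Ring) z (S n) - pow_n (K := C_Ring) w (S n)) * a (S n))%C by ring.
  eapply Rle_trans; [apply Cmod_triangle|]; rewrite Cmod_mult.
  assert (L := pow_n_lipschitz z w rho n Hz Hw).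
  assert (Hp : 0 <= (4 * rho) ^ n) by (apply pow_le; lra).
  assert (Hrn : 0 <= rho ^ n) by (apply pow_le; lra).
  assert (T : Cmod (pow_n (K := C_Ring) z (S n) - pow_n (K := C_Ring) w (S n)) * Cmod (a (S n))
    <= (2 ^ n * rho ^ n * Cmod (z - w)) * (M * 2 ^ S n)).
  { apply Rmult_le_compat; auto using Cmod_ge_0.
    eapply Rle_trans; [exact L|].
    do 2 (apply Rmult_le_compat_r; [assumption|]); apply INR_le_pow2. }
  replace ((2 ^ n * rho ^ n * Cmod (z - w)) * (M * 2 ^ S n))
    with (2 * M * (4 * rho) ^ n * Cmod (z - w)) in T
    by (replace (4 * rho) with (2 * 2 * rho) by ring; rewrite !Rpow_mult_distr; simpl; ring).
  assert (Q : 4 * M * (4 * rho) ^ S n * Cmod (z - w) <= 2 * M * (4 * rho) ^ n * Cmod (z - w)).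
  { apply Rmult_le_compat_r; [exact D|]; simpl.
    assert (R1 : (4 * rho) * (4 * rho) ^ n <= / 2 * (4 * rho) ^ n) by (apply Rmult_le_compat_r; lra).
    assert (R2 := Rmult_le_compat_l _ _ _ (Rlt_le _ _ HM) R1).
    revert R2; generalize ((4 * rho) ^ n); intros X R2; lra. }
  lra.
Qed.

(** One estimate with two uses: [w = 0] bounds the Taylor remainder of [f], and [w] tending to [z]
    bounds that of its derivative. The constant is 256 = 4 * 4^3. *)
Lemma pseries_remainder_lipschitz (f : C -> C) (a : nat -> C) :
  analytic_series f a ->
  exists K, 0 < K /\ forall rho z w, Cmod z <= rho -> Cmod w <= rho -> rho <= / 8 ->
    Cmod ((f z - taylor3 a z) - (f w - taylor3 a w)) <= K * rho ^ 3 * Cmod (z - w).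
Proof.
intros Hf; destruct (pseries_coef_bound f a Hf) as [M [HM Ha]].
exists (256 * M); split; [lra|]; intros rho z w Hz Hw Hr.
apply Rnot_lt_le; intros Hn.
set (X := Cmod ((f z - taylor3 a z) - (f w - taylor3 a w))) in *.
assert (He : 0 < (X - 256 * M * rho ^ 3 * Cmod (z - w)) / 2) by lra.
destruct Hf as [_ Hf].
destruct (partial_sum_lim a z _ (Hf z ltac:(unfold unit_disk; lra)) _ He) as [N1 H1].
destruct (partial_sum_lim a w _ (Hf w ltac:(unfold unit_disk; lra)) _ He) as [N2 H2].
specialize (H1 (3 + (N1 + N2))%nat ltac:(lia)); specialize (H2 (3 + (N1 + N2))%nat ltac:(lia)).
assert (P := partial_sum_remainder a M rho z w (N1 + N2) HM Ha Hz Hw Hr).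
set (n := (3 + (N1 + N2))%nat) in *.
assert (Hp : 0 <= (4 * rho) ^ n) by (apply pow_le; assert (A := Cmod_ge_0 z); lra).
assert (D := Cmod_ge_0 (z - w)).
assert (P' : 4 * M * ((4 * rho) ^ 3 - (4 * rho) ^ n) * Cmod (z - w) <= 256 * M * rho ^ 3 * Cmod (z - w)).
{ apply Rmult_le_compat_r; [exact D|]. replace (256 * M * rho ^ 3) with (4 * M * (4 * rho) ^ 3) by ring.
  apply Rmult_le_compat_l; lra. }
assert (T : X <= Cmod ((partial_sum a z n - taylor3 a z) - (partial_sum a w n - taylor3 a w))
  + Cmod (partial_sum a z n - f z) + Cmod (partial_sum a w n - f w)).
{ unfold X; replace (_ - _)%C with
    ((partial_sum a z n - taylor3 a z - (partial_sum a w n - taylor3 a w))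
     + - (partial_sum a z n - f z) + (partial_sum a w n - f w))%C by ring.
  eapply Rle_trans; [apply Cmod_triangle|]; apply Rplus_le_compat_r.
  eapply Rle_trans; [apply Cmod_triangle|]; rewrite Cmod_opp; lra. }
lra.
Qed.

Lemma analytic_series_0 (f : C -> C) (a : nat -> C) : analytic_series f a -> f 0 = a 0%nat.
Proof.
intros [_ H].
assert (H0 : unit_disk 0) by (unfold unit_disk; rewrite Cmod_0; lra).
apply (filterlim_locally_unique (F := eventually) (V := C_NormedModule) _ _ _ (H 0 H0)).
exact (is_pseries_0 (K := C_AbsRing) (V := C_NormedModule) a).
Qed.

Lemma pseries_remainder_bound (f : C -> C) (a : nat -> C) :
  analytic_series f a ->
  exists K, 0 < K /\ forall z, Cmod z <= / 8 -> Cmod (f z - taylor3 a z) <= K * Cmod z ^ 4.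
Proof.
intros Hf; destruct (pseries_remainder_lipschitz f a Hf) as [K [HK H]].
exists K; split; [exact HK|]; intros z Hz.
assert (A := H (Cmod z) z 0 (Rle_refl _)); rewrite Cmod_0 in A.
specialize (A (Cmod_ge_0 z) Hz).
replace (f z - taylor3 a z - (f 0 - taylor3 a 0))%C with (f z - taylor3 a z)%C in A
  by (rewrite (analytic_series_0 f a Hf); unfold taylor3; ring).
replace (z - 0)%C with z in A by ring; simpl in *; lra.
Qed.

Lemma analytic_series_jet2 (f : C -> C) (a : nat -> C) :
  analytic_series f a -> jet2 f (a 0%nat) (a 1%nat) (a 2%nat).
Proof.
intros Hf; destruct (pseries_remainder_bound f a Hf) as [K [HK H]].
apply jet2_of_bound with (K := K + Cmod (a 3%nat)) (d := / 8); [lra|]; intros z Hz.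
replace (_ - _)%C with ((f z - taylor3 a z) + a 3%nat * (z * z * z))%C by (unfold taylor3; ring).
eapply Rle_trans; [apply Cmod_triangle|]; rewrite !Cmod_mult.
specialize (H z (Rlt_le _ _ Hz)).
assert (B := Cmod_ge_0 z); assert (P : 0 <= Cmod z ^ 3) by now apply pow_le.
assert (Cmod z ^ 4 <= Cmod z ^ 3).
{ replace (Cmod z ^ 4) with (Cmod z * Cmod z ^ 3) by ring; nra. }
assert (K * Cmod z ^ 4 <= K * Cmod z ^ 3) by (apply Rmult_le_compat_l; lra).
simpl in *; lra.
Qed.

(** Division by [z] brings the third coefficient into a 2-jet. *)
Lemma analytic_series_quotient_jet2 (f : C -> C) (a : nat -> C) :
  analytic_series f a -> a 0%nat = 0 ->
  exists k, (forall z, f z = z * k z)%C /\ jet2 k (a 1%nat) (a 2%nat) (a 3%nat).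
Proof.
intros Hf H0; destruct (pseries_remainder_bound f a Hf) as [K [HK H]].
exists (fun z => if Ceq_dec z 0 then a 1%nat else f z / z)%C; split.
- intros z; destruct (Ceq_dec z 0) as [->|n]; [|field; exact n].
  rewrite (analytic_series_0 f a Hf), H0; ring.
- apply jet2_of_bound with (K := K) (d := / 8); [lra|]; intros z Hz.
  destruct (Ceq_dec z 0) as [->|n].
  + replace (_ - _)%C with (RtoC 0) by ring; rewrite Cmod_0; simpl; lra.
  + specialize (H z (Rlt_le _ _ Hz)).
    replace (_ - _)%C with ((f z - taylor3 a z) / z)%C
      by (unfold taylor3; rewrite H0; field; exact n).
    rewrite Cmod_div by exact n; apply Rle_div_l; [now apply Cmod_gt_0|].
    simpl in *; lra.
Qed.

(** The difference quotients of the remainder are uniformly small, hence so is its derivative; the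
    series is never differentiated term by term. *)
Lemma C_derive_jet2 (f : C -> C) (a : nat -> C) :
  analytic_series f a -> jet2 (C_derive f) (a 1%nat) (2 * a 2%nat) (3 * a 3%nat).
Proof.
intros Hf; destruct (pseries_remainder_lipschitz f a Hf) as [K [HK H]].
assert (L : forall z rho, Cmod z < rho -> rho <= / 8 ->
  Cmod (C_derive f z - (a 1%nat + 2 * a 2%nat * z + 3 * a 3%nat * (z * z))) <= K * rho ^ 3).
{ intros z rho Hz Hr.
  destruct (is_derive_caratheodory f z _ (C_derive_correct f z 0 (proj1 Hf z ltac:(unfold unit_disk; lra))))
    as [q [Hq [Eq Eqf]]].
  (* [p] is the slope at [z] of [f - taylor3 a]: the bracket collects the divided differences of the
     monomials. *)
  pose (p := fun w => (q w - (a 1%nat + a 2%nat * (z + w) + a 3%nat * (z * z + z * w + w * w)))%C).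
  assert (Hp : ccont p z) by (unfold p; ccont_tac).
  replace (_ - _)%C with (p z) by (unfold p; rewrite Eq; ring).
  apply Rnot_lt_le; intros Hn.
  destruct (proj1 (ccontP p z) Hp (Cmod (p z) - K * rho ^ 3)) as [d [Hd Hpd]]; [lra|].
  pose (t := Rmin d (rho - Cmod z) / 2).
  assert (Ht : 0 < Rmin d (rho - Cmod z)) by (apply Rmin_pos; lra).
  assert (Ht1 := Rmin_l d (rho - Cmod z)); assert (Ht2 := Rmin_r d (rho - Cmod z)).
  assert (Htm : Cmod t = t) by (rewrite Cmod_R; apply Rabs_pos_eq; unfold t; lra).
  specialize (Hpd (z + t)%C); replace (z + t - z)%C with (RtoC t) in Hpd by ring.
  rewrite Htm in Hpd; specialize (Hpd ltac:(unfold t; lra)).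
  assert (Hzt : Cmod (z + t) <= rho).
  { eapply Rle_trans; [apply Cmod_triangle|]; rewrite Htm; unfold t; lra. }
  assert (A := H rho (z + t)%C z Hzt (Rlt_le _ _ Hz) Hr).
  replace (z + t - z)%C with (RtoC t) in A by ring.
  replace (f (z + t)%C - taylor3 a (z + t) - (f z - taylor3 a z))%C with (t * p (z + t)%C)%C in A
    by (rewrite (Eqf (z + t)%C); unfold p, taylor3; ring).
  rewrite Cmod_mult, Htm in A.
  assert (B : Cmod (p (z + t)%C) <= K * rho ^ 3).
  { apply Rmult_le_reg_l with t; [unfold t; lra|]; lra. }
  assert (T : Cmod (p z) <= Cmod (p (z + t)%C) + Cmod (p (z + t)%C - p z)); [|lra].
  replace (p z) with (p (z + t)%C + - (p (z + t)%C - p z))%C at 1 by ring.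
  eapply Rle_trans; [apply Cmod_triangle|]; rewrite Cmod_opp; lra. }
(* [L] needs [rho] strictly above [Cmod z]. Taking [rho = 2 * Cmod z] gives the factor 8 and the
   radius 1/16; at [z = 0] a small positive [rho] is used instead. *)
apply jet2_of_bound with (K := 8 * K) (d := / 16); [lra|]; intros z Hz.
destruct (Ceq_dec z 0) as [->|n].
- rewrite Cmod_0.
  apply Rnot_lt_le; intros Hn; simpl in Hn; rewrite Rmult_0_l, Rmult_0_r in Hn.
  set (X := Cmod _) in Hn.
  pose (rho := Rmin (/ 8) (X / (2 * K))).
  assert (HX : 0 < X / (2 * K)) by (apply Rdiv_lt_0_compat; lra).
  assert (Hrho : 0 < rho) by (apply Rmin_pos; lra).
  assert (R1 : rho <= / 8) by apply Rmin_l.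
  assert (R2 : rho <= X / (2 * K)) by apply Rmin_r.
  assert (A := L 0 rho ltac:(rewrite Cmod_0; exact Hrho) R1); fold X in A.
  apply Rle_div_r in R2; [|lra].
  assert (rho ^ 3 <= rho) by (simpl; nra).
  assert (K * rho ^ 3 <= K * rho) by (apply Rmult_le_compat_l; lra).
  lra.
- assert (0 < Cmod z) by now apply Cmod_gt_0.
  replace (8 * K * Cmod z ^ 3) with (K * (2 * Cmod z) ^ 3) by ring.
  apply L; lra.
Qed.

(** * The principal logarithm and power near 1 *)

Lemma sin_arg (z : C) :
  z <> 0 -> sqrt (1 - Rsqr (Re z / Cmod z)) = Rabs (Im z) / Cmod z.
Proof.
intros Hz; assert (Hm : 0 < Cmod z) by now apply Cmod_gt_0.
replace (1 - Rsqr (Re z / Cmod z)) with (Rsqr (Im z / Cmod z)).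
- rewrite sqrt_Rsqr_abs, Rabs_div, (Rabs_pos_eq (Cmod z)) by lra; reflexivity.
- assert (B := Cmod2_alt z); unfold Rsqr.
  apply Rmult_eq_reg_r with (Cmod z ^ 2); [|apply pow_nonzero; lra].
  transitivity (Im z ^ 2); [field; lra|]; transitivity (Cmod z ^ 2 - Re z ^ 2); [lra | field; lra].
Qed.

Lemma atan_le (y : R) : 0 <= y -> atan y <= y.
Proof.
intros [Hy| <-]; [|rewrite atan_0; lra].
destruct (MVT_gen atan 0 y (fun x => / (1 + x ^ 2))) as [c [_ Ec]].
- intros x _; auto_derive; auto; field; nra.
- intros x _; apply derivable_continuous_pt, derivable_pt_atan.
- rewrite atan_0, !Rminus_0_r in Ec; rewrite Ec.
  assert (/ (1 + c ^ 2) <= 1).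
  { rewrite <- Rinv_1; apply Rinv_le_contravar; [lra|]; assert (A := pow2_ge_0 c); lra. }
  nra.
Qed.

(** In the right half-plane the modulus of the argument is the arctangent of
    [Rabs (Im z) / Re z]. *)
Lemma Carg_bound (z : C) : 0 < Re z -> Rabs (Carg z) <= Rabs (Im z) / Re z.
Proof.
intros Hz.
assert (Hm : 0 < Cmod z) by (eapply Rlt_le_trans; [exact Hz | apply Re_le_Cmod]).
assert (HA : Rabs (Carg z) = acos (Re z / Cmod z)).
{ assert (A := acos_bound (Re z / Cmod z)); unfold Carg; destruct (Rlt_dec (Im z) 0);
    [rewrite Rabs_Ropp|]; apply Rabs_pos_eq; lra. }
rewrite HA, acos_atan by (apply Rdiv_lt_0_compat; lra).
rewrite sin_arg by now apply Cmod_gt_0.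
replace (Rabs (Im z) / Cmod z / (Re z / Cmod z)) with (Rabs (Im z) / Re z) by (field; lra).
apply atan_le, Rdiv_le_0_compat; [apply Rabs_pos | exact Hz].
Qed.

Lemma Cexp_Clog (z : C) : z <> 0 -> Cexp (Clog z) = z.
Proof.
intros Hz; assert (Hm : 0 < Cmod z) by now apply Cmod_gt_0.
assert (HR : -1 <= Re z / Cmod z <= 1).
{ assert (A := re_le_Cmod z); apply Rabs_le_between in A.
  split; [apply Rle_div_r | apply Rle_div_l]; lra. }
assert (Hs := sin_arg z Hz).
apply injective_projections; simpl; rewrite exp_ln by exact Hm; unfold Carg;
  destruct (Rlt_dec (Im z) 0) as [h|h];
  rewrite ?cos_neg, ?sin_neg, ?cos_acos, ?sin_acos, ?Hs by exact HR.
- unfold Re; field; lra.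
- unfold Re; field; lra.
- rewrite Rabs_left by exact h; unfold Im; field; lra.
- rewrite Rabs_pos_eq by lra; unfold Im; field; lra.
Qed.

(** From [ln x <= x - 1] applied to both [m] and [/ m]. *)
Lemma ln_bound (m : R) : / 2 <= m -> Rabs (ln m) <= 2 * Rabs (m - 1).
Proof.
intros Hm.
assert (L : forall x, 0 < x -> ln x <= x - 1).
{ intros x Hx; rewrite <- (ln_exp (x - 1)); apply ln_le; [exact Hx|].
  assert (A := exp_ineq1_le (x - 1)); lra. }
assert (A := L m ltac:(lra)).
assert (Hi : 0 < / m) by (apply Rinv_0_lt_compat; lra).
assert (B := L (/ m) Hi); rewrite ln_Rinv in B by lra.
assert (E : m * / m = 1) by (apply Rinv_r; lra).
assert (I2 : / m <= 2) by nra.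
assert (B' : - ln m <= / m * (1 - m)) by nra.
destruct (Rle_dec 1 m); [rewrite (Rabs_pos_eq (m - 1)) by lra | rewrite (Rabs_left (m - 1)) by lra];
  apply Rabs_le; nra.
Qed.

Lemma Clog_1 : Clog 1 = 0.
Proof.
unfold Clog, Carg; rewrite Cmod_1, ln_1; simpl.
destruct (Rlt_dec 0 0); [lra|]; unfold Rdiv; now rewrite Rinv_1, Rmult_1_r, acos_1.
Qed.

Lemma Clog_cont_1 : ccont (fun z => Clog (1 + z)) 0.
Proof.
(* Radius 1/2 keeps [1 + w] in the half-plane of real part above 1/2, where [ln] of the modulus and
   the argument are each at most [2 * Cmod w]; hence [eps / 4]. *)
apply ccontP; intros eps He; exists (Rmin (/ 2) (eps / 4)).
split; [apply Rmin_pos; lra|]; intros w Hw.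
assert (H1 := Rmin_l (/ 2) (eps / 4)); assert (H2 := Rmin_r (/ 2) (eps / 4)).
replace (w - 0)%C with w in Hw by ring.
replace (1 + 0)%C with (RtoC 1) by ring; rewrite Clog_1.
replace (Clog (1 + w) - 0)%C with (Clog (1 + w)) by ring.
assert (Hr := re_le_Cmod w); assert (Hi := im_le_Cmod w).
assert (Hm : Rabs (Cmod (1 + w) - 1) <= Cmod w).
{ assert (A := Cmod_triangle 1 w); assert (B := Cmod_triangle (1 + w) (- w)).
  replace (1 + w + - w)%C with (RtoC 1) in B by ring.
  rewrite Cmod_opp in B; rewrite Cmod_1 in *; apply Rabs_le; lra. }
assert (Hm' := Hm); apply Rabs_le_between in Hm'; apply Rabs_le_between in Hr.
assert (HL := ln_bound (Cmod (1 + w)) ltac:(lra)).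
assert (ER : Re (1 + w)%C = 1 + Re w) by reflexivity.
assert (EI : Im (1 + w)%C = Im w) by (destruct w; simpl; ring).
assert (HA := Carg_bound (1 + w) ltac:(lra)).
rewrite ER, EI in HA.
assert (HB : Rabs (Im w) / (1 + Re w) <= 2 * Cmod w).
{ apply Rle_div_l; [lra|]; assert (A := Cmod_ge_0 w); nra. }
eapply Rle_lt_trans; [apply Cmod_le_abs|]; unfold Clog at 1 2; simpl; lra.
Qed.

(* The logarithm is expanded by inverting Cexp, which only needs its
   continuity at 1. *)
Lemma Clog_jet2 : jet2 (fun z => Clog (1 + z)) 0 1 (- / 2)%C.
Proof.
destruct Cexp_jet2 as [q [Hq [Eq HE]]].
assert (Hl := Clog_cont_1); set (l := fun z => Clog (1 + z)) in *.
assert (l0 : l 0 = 0) by (unfold l; replace (1 + 0)%C with (RtoC 1) by ring; apply Clog_1).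
assert (Hql : ccont (fun z => q (l z)) 0) by (apply ccont_comp; [|rewrite l0]; assumption).
(* Expanding [1 + w = Cexp (l w)] gives [w = l w * den w], so [l w - w] equals
   [- (w / den w)^2 * q (l w)]. *)
pose (den z := (1 + l z * q (l z))%C).
assert (Hden : ccont den 0) by (unfold den; ccont_tac).
assert (den0 : den 0 = 1) by (unfold den; rewrite l0; ring).
assert (Hi : ccont (fun z => / den z)%C 0).
{ apply ccont_inv; [exact Hden|]; rewrite den0; intro E; injection E; lra. }
apply jet2_ext_loc with (fun z => 0 + 1 * z + z * z * (- (/ den z * / den z) * q (l z)))%C.
- destruct (proj1 (ccontP den 0) Hden 1 Rlt_0_1) as [d [Hd H]].
  exists (Rmin d 1); split; [apply Rmin_pos; lra|]; intros w Hw.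
  assert (R1 := Rmin_l d 1); assert (R2 := Rmin_r d 1).
  assert (Hdw : den w <> 0).
  { specialize (H w); replace (w - 0)%C with w in H by ring; rewrite den0 in H.
    intros E; rewrite E in H; replace (0 - 1)%C with (- (1))%C in H by ring.
    rewrite Cmod_m1 in H; lra. }
  assert (Hw1 : (1 + w)%C <> 0).
  { intro E; replace w with (- (1))%C in Hw
      by (transitivity (1 + w - 1)%C; [rewrite E|]; ring).
    rewrite Cmod_m1 in Hw; lra. }
  assert (E := HE (l w)); unfold l at 1 in E; rewrite Cexp_Clog in E by exact Hw1.
  assert (E1 : w = (l w * den w)%C).
  { transitivity (1 + w - 1)%C; [ring|]; rewrite E; unfold den; ring. }
  rewrite E1 at 1 2 3.
  transitivity (l w * den w - l w * l w * q (l w))%C; [field; exact Hdw | unfold den; ring].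
- exists (fun z => - (/ den z * / den z) * q (l z))%C; split; [ccont_tac|split; [|reflexivity]].
  rewrite den0, l0, Eq; field.
Qed.

Lemma Cpower_jet2 (s : C) :
  jet2 (fun z => Cpower (1 + z) s) 1 s (s * (s - 1) / 2)%C.
Proof.
assert (A := jet2_affine _ s 0 _ _ _ Clog_jet2).
replace (s * 0 + 0)%C with (RtoC 0) in A by ring.
assert (B := jet2_comp _ _ _ _ _ _ _ Cexp_jet2 A).
replace (1 * (s * 1))%C with s in B by ring.
replace (s * (s - 1) / 2)%C
  with (1 * (s * - / 2) + / 2 * (s * 1 * (s * 1)))%C by field.
revert B; apply jet2_ext_loc; exists 1; split; [lra|]; intros w _.
unfold Cpower; f_equal; ring.
Qed.

(** * The coefficient equations *)

Lemma locally_Cmod (P : C -> Prop) :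
  locally (RtoC 0) P -> exists d, 0 < d /\ forall w, Cmod w < d -> P w.
Proof.
intros [d H]; exists d; split; [apply cond_pos|]; intros w Hw.
apply H, C_NormedModule_mixin_compat1.
now replace (minus w (RtoC 0)) with w by (unfold minus, plus, opp; simpl; ring).
Qed.

(** [is_J] quantifies over its own coefficient sequence; this identifies it with the given one in
    the two places that matter. *)
Lemma class_A_unique (f : C -> C) (a b : nat -> C) :
  class_A f a -> class_A f b -> a 2%nat = b 2%nat /\ a 3%nat = b 3%nat.
Proof.
intros [a0 [a1 Ha]] [b0 [b1 Hb]].
destruct (analytic_series_quotient_jet2 f a Ha a0) as [k [Ek Hk]].
destruct (analytic_series_quotient_jet2 f b Hb b0) as [m [Em Hm]].
assert (Hk' : jet2 k (b 1%nat) (b 2%nat) (b 3%nat)).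
{ assert (Em0 := proj2 (jet2_cont _ _ _ _ Hm)).
  revert Hm; apply jet2_ext_loc; exists 1; split; [lra|]; intros w _.
  destruct (Ceq_dec w 0) as [->|n].
  - now rewrite (proj2 (jet2_cont _ _ _ _ Hk)), Em0, a1, b1.
  - transitivity (f w / w)%C; [rewrite Em | rewrite Ek]; field; exact n. }
exact (proj2 (jet2_unique _ _ _ _ _ _ _ Hk Hk')).
Qed.

(** With [f z = z * k z] and [g z = z * m z], the relation [f (g w) = w] divided by [w] is
    [m w * k (g w) = 1], whose 2-jet contains the third coefficients. *)
Lemma inverse_coefs (f g : C -> C) (a d : nat -> C) :
  class_A f a -> class_A g d -> locally (RtoC 0) (fun w => f (g w) = w) ->
  d 2%nat = (- a 2%nat)%C /\ d 3%nat = (2 * (a 2%nat * a 2%nat) - a 3%nat)%C.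
Proof.
intros [a0 [a1 Ha]] [d0 [d1 Hd]] Hl.
destruct (analytic_series_quotient_jet2 f a Ha a0) as [k [Ek Hk]].
destruct (analytic_series_quotient_jet2 g d Hd d0) as [m [Em Hm]].
assert (Hg := analytic_series_jet2 g d Hd).
rewrite a1 in Hk; rewrite d1 in Hm; rewrite d0, d1 in Hg.
assert (H := jet2_mult _ _ _ _ _ _ _ _ Hm (jet2_comp _ _ _ _ _ _ _ Hk Hg)).
assert (H1 : jet2 (fun z => m z * k (g z))%C 1 0 0).
{ apply jet2_ext_loc with (fun _ => RtoC 1).
  - destruct (locally_Cmod _ Hl) as [e [He Hw]]; exists e; split; [exact He|]; intros w H0.
    destruct (Ceq_dec w 0) as [->|n].
    + rewrite (proj2 (jet2_cont _ _ _ _ H)); ring.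
    + specialize (Hw w H0); rewrite Ek in Hw.
      transitivity ((g w * k (g w)) / w)%C; [rewrite Hw; field; exact n|].
      rewrite (Em w) at 1; field; exact n.
  - exists (fun _ => RtoC 0); repeat split; [ccont_tac | intros; ring]. }
destruct (jet2_unique _ _ _ _ _ _ _ H H1) as [_ [E1 E2]].
assert (D2 : d 2%nat = (- a 2%nat)%C).
{ transitivity ((1 * (a 2%nat * 1) + d 2%nat * 1) - a 2%nat)%C; [ring | rewrite E1; ring]. }
split; [exact D2|].
match type of E2 with ?e = _ => transitivity (e - a 3%nat - 2 * (a 2%nat * d 2%nat))%C end.
- ring.
- rewrite E2, D2; ring.
Qed.

Lemma branch_jet2 (F k P : C -> C) (s : R) (A2 A3 : C) :
  (forall z, F z = z * k z)%C -> jet2 k 1 A2 A3 -> analytic_branch F s P ->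
  jet2 P 1 (s * A2) (s * A3 + s * (s - 1) / 2 * (A2 * A2)).
Proof.
intros EF Hk [_ [P0 HP]].
assert (Hk' := jet2_affine _ 1 (- (1)) _ _ _ Hk).
replace (1 * 1 + - (1))%C with (RtoC 0) in Hk' by ring; rewrite !Cmult_1_l in Hk'.
assert (H := jet2_comp _ _ _ _ _ _ _ (Cpower_jet2 s) Hk').
assert (H0 := proj2 (jet2_cont _ _ _ _ H)).
revert H; apply jet2_ext_loc.
destruct (locally_Cmod _ HP) as [e [He Hw]]; exists e; split; [exact He|]; intros w Hwe.
(* At 0 the quotient [F w / w] says nothing; the normalisation of the branch supplies the value. *)
destruct (Ceq_dec w 0) as [->|n]; [now rewrite H0, P0|].
rewrite (Hw w Hwe n), EF; f_equal; field; exact n.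
Qed.

(* Comparing psi (phi o u - 1) with an expansion of the left-hand side
   determines u to second order when c0 <> 0, so that no power series of u is
   needed. *)
Lemma quasi_subordinate_coefs (psi G phi : C -> C) (B c : nat -> C) (g1 g2 : C) :
  analytic_series phi B -> analytic_series psi c -> B 0%nat = 1 -> B 1%nat <> 0 ->
  jet2 G 0 g1 g2 -> quasi_subordinate psi G (fun z => phi z - 1)%C ->
  exists u1 u2 : C, Cmod u2 + Cmod u1 ^ 2 <= 1 /\
    g1 = (c 0%nat * B 1%nat * u1)%C /\
    g2 = (c 0%nat * (B 1%nat * u2 + B 2%nat * (u1 * u1)) + c 1%nat * B 1%nat * u1)%C.
Proof.
intros Hphi Hpsi B0 HB1 [qG [HqG [EqG EG]]] [u [Hu [u0 [Hu1 HGu]]]].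
assert (Hs : schwarz_function u) by (repeat split; assumption).
destruct (Hu 0) as [l Hl]; [unfold unit_disk; rewrite Cmod_0; lra|].
destruct (is_derive_caratheodory u 0 l Hl) as [k [Hk [Ek0 Ek']]].
assert (Ek : forall z, u z = (z * k z)%C) by (intros z; rewrite Ek', u0; ring).
destruct (analytic_series_jet2 phi B Hphi) as [qp [Hqp [Eqp Ep]]].
destruct (analytic_series_jet2 psi c Hpsi) as [qs [Hqs [Eqs Es]]].
assert (Huc : ccont u 0) by (now apply ccont_of_slope with k).
assert (Hqu : ccont (fun z => qp (u z)) 0) by (apply ccont_comp; [|rewrite u0]; assumption).
(* The subordination identity with one factor [z] removed. *)
assert (E0 : forall z : C, unit_disk z -> z <> 0 ->
  (g1 + z * qG z = (c 0%nat + c 1%nat * z + z * z * qs z) * (B 1%nat * k z + z * (k z * k z) * qp (u z)))%C).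
{ intros z Hz n.
  transitivity (G z / z)%C; [rewrite EG; field; exact n|].
  rewrite (HGu z Hz), Es, Ep, B0; set (y := qp (u z)); rewrite (Ek z); field; exact n. }
assert (Eg1 : g1 = (c 0%nat * B 1%nat * l)%C).
{ transitivity (g1 + 0 * qG 0)%C; [ring|].
  transitivity ((c 0%nat + c 1%nat * 0 + 0 * 0 * qs 0) * (B 1%nat * k 0 + 0 * (k 0 * k 0) * qp (u 0)))%C;
    [|rewrite Ek0; ring].
  apply (ccont_unique (fun z => g1 + z * qG z)%C
    (fun z => (c 0%nat + c 1%nat * z + z * z * qs z) * (B 1%nat * k z + z * (k z * k z) * qp (u z)))%C);
    [ccont_tac.. |].
  exists 1; split; [lra|]; intros z Hz n; now apply E0. }
(* What a second division by [z] leaves: [c 0 * B 1 * (k z - l) = z * M z]. If [c 0] is not 0,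
   [M / (c 0 * B 1)] is thus the second-order remainder factor of [u]. *)
pose (M z := (qG z - c 1%nat * B 1%nat * k z - z * (qs z * B 1%nat * k z)
  - (c 0%nat + c 1%nat * z + z * z * qs z) * (k z * k z) * qp (u z))%C).
assert (HM : ccont M 0) by (unfold M; ccont_tac).
assert (M0 : M 0 = (g2 - c 1%nat * B 1%nat * l - c 0%nat * (l * l) * B 2%nat)%C)
  by (unfold M; rewrite EqG, Ek0, u0, Eqp; ring).
assert (EM : forall z : C, unit_disk z -> z <> 0 -> (c 0%nat * B 1%nat * (k z - l) = z * M z)%C).
{ intros z Hz n; assert (E := E0 z Hz n); unfold M.
  transitivity ((c 0%nat + c 1%nat * z + z * z * qs z) * (B 1%nat * k z + z * (k z * k z) * qp (u z))
    - g1 - z * (c 1%nat * B 1%nat * k z + z * (qs z * B 1%nat * k z)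
    + (c 0%nat + c 1%nat * z + z * z * qs z) * (k z * k z) * qp (u z)))%C;
    [rewrite Eg1; ring | rewrite <- E; ring]. }
exists l; destruct (Ceq_dec (c 0%nat) 0) as [c0|c0].
(* Here the equation does not determine the second coefficient of [u], but it enters [g2] only with
   the factor [c 0 = 0], so 0 serves, and the first-order Schwarz bound is enough. *)
- exists 0; split; [|split; [exact Eg1|]].
  + assert (A := schwarz_coef1 u k Hs Hk Ek); rewrite Ek0 in A.
    rewrite Cmod_0; assert (A' := Cmod_ge_0 l); simpl; nra.
  + assert (E : M 0 = 0).
    { apply (ccont_unique M (fun _ => RtoC 0)); [exact HM | ccont_tac |].
      exists 1; split; [lra|]; intros z Hz n; assert (E := EM z Hz n); rewrite c0 in E.
      transitivity (z * M z / z)%C; [field; exact n|]; rewrite <- E; field; exact n. }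
    rewrite M0 in E; rewrite c0 in *.
    transitivity (g2 - c 1%nat * B 1%nat * l - 0 * (l * l) * B 2%nat + c 1%nat * B 1%nat * l)%C;
      [ring | rewrite E; ring].
- exists (M 0 / (c 0%nat * B 1%nat))%C; split; [|split; [exact Eg1|]].
  + apply (schwarz_coef2 u l _ Hs).
    apply jet2_ext_loc with (fun z => 0 + l * z + z * z * (M z * / (c 0%nat * B 1%nat)))%C.
    * exists 1; split; [lra|]; intros z Hz; destruct (Ceq_dec z 0) as [->|n]; [rewrite u0; ring|].
      rewrite Ek; transitivity (z * (l + (z * M z) / (c 0%nat * B 1%nat)))%C;
        [field; auto | rewrite <- (EM z Hz n); field; auto].
    * exists (fun z => M z * / (c 0%nat * B 1%nat))%C; split; [ccont_tac|split; reflexivity].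
  + rewrite M0; field; auto.
Qed.

Lemma Theta_pos (mu b : C) (k : nat) : 0 < Theta mu b k.
Proof. unfold Theta, Cpower; rewrite Cmod_Cexp; apply exp_pos. Qed.

(** Write s = lam - 1, and A2, A3 for the coefficients of F. The product F' P has first coefficient
    (2 + s) A2 and second coefficient (3 + s) A3 + (2 s + s (s - 1) / 2) A2^2, and 2 s + s (s - 1) /
    2 = (lam - 1) (lam + 2) / 2. *)
Lemma B_condition_coefs (mu b gamma : C) (lam : R) (phi psi f : C -> C) (a B c : nat -> C) :
  gamma <> 0 -> analytic_series phi B -> analytic_series psi c ->
  B 0%nat = 1 -> B 1%nat <> 0 -> class_A f a ->
  B_condition mu b gamma lam phi psi f ->
  exists u1 u2 : C, Cmod u2 + Cmod u1 ^ 2 <= 1 /\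
    ((1 + lam) * (Theta mu b 2 * a 2%nat) = gamma * (c 0%nat * B 1%nat * u1))%C /\
    ((lam + 2) * (Theta mu b 3 * a 3%nat)
       + (lam - 1) * (lam + 2) / 2 * ((Theta mu b 2 * a 2%nat) * (Theta mu b 2 * a 2%nat))
     = gamma * (c 0%nat * (B 1%nat * u2 + B 2%nat * (u1 * u1)) + c 1%nat * B 1%nat * u1))%C.
Proof.
intros Hg Hphi Hpsi B0 B1 Ha [F [P [[a' [Ha' [A0 [A1 HF]]]] [HP HQ]]]].
destruct (class_A_unique f a a' Ha Ha') as [E2 E3]; rewrite E2, E3.
destruct (analytic_series_quotient_jet2 F _ HF A0) as [k [Ek Hk]].
assert (HD := C_derive_jet2 F _ HF).
cbv beta iota delta [J_coef] in Hk, HD.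
set (A2 := (Theta mu b 2 * a' 2%nat)%C) in *; set (A3 := (Theta mu b 3 * a' 3%nat)%C) in *.
assert (HPj := branch_jet2 F k P _ A2 A3 Ek Hk HP).
assert (H := jet2_affine _ (1 / gamma) (- (1 / gamma)) _ _ _ (jet2_mult _ _ _ _ _ _ _ _ HD HPj)).
rewrite RtoC_minus in H.
eapply jet2_ext_loc with (g := fun z => (1 / gamma * (C_derive F z * P z - 1))%C) in H;
  [|exists 1; split; [lra|]; intros; ring].
replace (1 / gamma * (1 * 1) + - (1 / gamma))%C with (RtoC 0) in H by (field; exact Hg).
destruct (quasi_subordinate_coefs psi _ phi B c _ _ Hphi Hpsi B0 B1 H HQ)
  as [u1 [u2 [Hu [F1 F2]]]].
exists u1, u2; split; [exact Hu|]; split.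
- rewrite <- F1; field; exact Hg.
- rewrite <- F2; field; exact Hg.
Qed.

(** * From the coefficient equations to the two bounds *)

Lemma Cmod_le_1_of_schwarz (u1 u2 : C) :
  Cmod u2 + Cmod u1 ^ 2 <= 1 -> Cmod u1 <= 1 /\ Cmod u2 <= 1.
Proof. intros H; assert (A := Cmod_ge_0 u1); assert (B := Cmod_ge_0 u2); split; nra. Qed.

Theorem theorem3p1
  (mu b gamma : C) (lam : R)
  (hb : forall n : nat, b <> RtoC (- INR n))
  (hgamma : gamma <> RtoC 0)
  (hlam : 0 <= lam)
  (phi : C -> C) (B : nat -> C) (B1 : R)
  (hphi : analytic_series phi B)
  (hB0 : B 0%nat = RtoC 1)
  (hB1 : B 1%nat = RtoC B1)
  (hB1pos : 0 < B1)
  (psi : C -> C) (c : nat -> C)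
  (hpsi : analytic_series psi c)
  (hpsi1 : forall z : C, unit_disk z -> Cmod (psi z) < 1)
  (f : C -> C) (a : nat -> C)
  (ha : class_A f a)
  (hf : class_B_Sigma mu b gamma lam phi psi f) :
  let T2 := Theta mu b 2 in
  let T3 := Theta mu b 3 in
  let D :=
    Cmod (gamma * c 0%nat * RtoC (B1 ^ 2)
            * RtoC ((lam - 1) * (lam + 2) * T2 ^ 2 + 2 * (lam + 2) * T3)
          - RtoC 2 * (B 2%nat - RtoC B1) * RtoC ((1 + lam) ^ 2 * T2 ^ 2))%C in
  (* For D = 0 the first bound is void (an infinite right-hand side). *)
  (D <> 0 ->
   Cmod (a 2%nat) <= Cmod gamma * Cmod (c 0%nat) * B1 * sqrt (2 * B1) / sqrt D)
  /\
  Cmod (a 3%nat) <=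
    Cmod gamma * Cmod (c 0%nat) * B1 / ((lam + 2) * T3)
    + Cmod gamma * Cmod (c 1%nat) * B1 / ((lam + 2) * T3)
    + (Cmod gamma * Cmod (c 0%nat) * B1 / ((1 + lam) * T2)) ^ 2.
Proof.
intros T2 T3 D.
assert (HT2 : 0 < T2) by apply Theta_pos.
assert (HT3 : 0 < T3) by apply Theta_pos.
destruct hf as [g [[_ [_ [_ Hinv]]] [Hf Hg]]].
assert (HB : B 1%nat <> 0) by (rewrite hB1; intro E; injection E; lra).
(* [univalent_inverse] makes [g] analytic only in the sense of differentiability; its normalised
   power series is read off from [is_J]. *)
assert (Hgd : exists d, class_A g d) by (destruct Hg as [F [P [[d [Hd _]] _]]]; now exists d).
destruct Hgd as [d Hd].
assert (Hl : locally (RtoC 0) (fun w : C => f (g w) = w))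
  by (apply filter_imp with (2 := Hinv); tauto).
destruct (inverse_coefs f g a d ha Hd Hl) as [D2 D3].
destruct (B_condition_coefs mu b gamma lam phi psi f a B c hgamma hphi hpsi hB0 HB ha Hf)
  as [u1 [u2 [Hu [E1 E2]]]].
destruct (B_condition_coefs mu b gamma lam phi psi g d B c hgamma hphi hpsi hB0 HB Hd Hg)
  as [v1 [v2 [Hv [E3 E4]]]].
fold T2 in E1, E2, E3, E4; fold T3 in E2, E4.
rewrite D2 in E3, E4; rewrite D3 in E4; rewrite hB1 in E1, E2, E3, E4.
clear Hf Hg Hinv Hl Hd D2 D3 d g ha hphi hpsi hpsi1 hB0 hB1 HB hb.
set (a2 := a 2%nat) in *; set (a3 := a 3%nat) in *; set (c0 := c 0%nat) in *; set (c1 := c 1%nat) in *.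
set (B2 := B 2%nat) in *.
assert (L1 : RtoC (1 + lam) <> 0) by (intro E; injection E; lra).
assert (L2 : RtoC (lam + 2) <> 0) by (intro E; injection E; lra).
assert (NT2 : RtoC T2 <> 0) by (intro E; injection E; lra).
assert (NB : RtoC B1 <> 0) by (intro E; injection E; lra).
assert (Hc0 : c0 = 0 -> a2 = 0).
{ intros E; rewrite E in E1; rewrite <- RtoC_plus in E1.
  transitivity ((RtoC (1 + lam) * (T2 * a2)) / (RtoC (1 + lam) * T2))%C; [field; auto|].
  rewrite E1; field; auto. }
assert (Hv1 : c0 <> 0 -> v1 = (- u1)%C).
{ intros E; transitivity ((gamma * (c0 * B1 * v1)) / (gamma * c0 * B1))%C; [field; auto|].
  rewrite <- E3; transitivity (- ((1 + lam) * (T2 * a2)) / (gamma * c0 * B1))%C; [field; auto|].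
  rewrite E1; field; auto. }
destruct (Cmod_le_1_of_schwarz _ _ Hu) as [Hu1 Hu2].
destruct (Cmod_le_1_of_schwarz _ _ Hv) as [_ Hv2].
assert (Pg := Cmod_ge_0 gamma); assert (Pc0 := Cmod_ge_0 c0); assert (Pc1 := Cmod_ge_0 c1).
assert (Pa := Cmod_ge_0 a2).
assert (HB1m : Cmod B1 = B1) by (rewrite Cmod_R; apply Rabs_pos_eq; lra).
split.
- intros HD.
  assert (PD : 0 < D) by (assert (A : 0 <= D) by apply Cmod_ge_0; lra).
  apply Rle_div_r; [now apply sqrt_lt_R0|].
  assert (PR : 0 <= Cmod gamma * Cmod c0 * B1) by (repeat apply Rmult_le_pos; lra).
  destruct (Ceq_dec c0 0) as [E|Nc0].
  { rewrite (Hc0 E), Cmod_0, Rmult_0_l; apply Rmult_le_pos; [exact PR | apply sqrt_pos]. }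
  apply Rsqr_incr_0_var; [|apply Rmult_le_pos; [exact PR | apply sqrt_pos]].
  rewrite !Rsqr_mult, !Rsqr_sqrt by lra; unfold Rsqr.
  specialize (Hv1 Nc0); rewrite Hv1 in Hv, E4.
  rewrite Cmod_opp in Hv.
  (* The sum of the second-order equations times [gamma * c0 * B1^2], minus [2 * (B2 - B1)] times
     the square of the first-order one: a3 and the C1 terms cancel. *)
  assert (KEY : (a2 * a2 * (gamma * c0 * RtoC (B1 ^ 2)
            * RtoC ((lam - 1) * (lam + 2) * T2 ^ 2 + 2 * (lam + 2) * T3)
          - RtoC 2 * (B2 - RtoC B1) * RtoC ((1 + lam) ^ 2 * T2 ^ 2))
      = gamma * gamma * (c0 * c0) * (B1 * B1 * B1) * ((u2 + u1 * u1) + (v2 + u1 * u1)))%C).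
  { rewrite ?RtoC_plus, ?RtoC_mult, ?RtoC_pow, ?RtoC_plus, ?RtoC_minus, ?RtoC_mult.
    transitivity (gamma * c0 * (B1 * B1) *
        (((lam + 2) * (T3 * a3) + (lam - 1) * (lam + 2) / 2 * (T2 * a2 * (T2 * a2)))
         + ((lam + 2) * (T3 * (2 * (a2 * a2) - a3)) + (lam - 1) * (lam + 2) / 2 * (T2 * - a2 * (T2 * - a2))))
      - 2 * (B2 - B1) * (((1 + lam) * (T2 * a2)) * ((1 + lam) * (T2 * a2))))%C; [simpl; field|].
    rewrite E1, E2, E4; ring. }
  apply (f_equal Cmod) in KEY; rewrite !Cmod_mult in KEY; fold D in KEY; rewrite HB1m in KEY.
  assert (S : Cmod (u2 + u1 * u1 + (v2 + u1 * u1)) <= 2).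
  { eapply Rle_trans; [apply Cmod_triangle|].
    assert (A1 := Cmod_triangle u2 (u1 * u1)); assert (A2 := Cmod_triangle v2 (u1 * u1)).
    rewrite Cmod_mult in A1, A2; simpl in Hu, Hv; lra. }
  rewrite KEY.
  replace (Cmod gamma * Cmod gamma * (Cmod c0 * Cmod c0) * (B1 * B1) * (2 * B1))
    with (Cmod gamma * Cmod gamma * (Cmod c0 * Cmod c0) * (B1 * B1 * B1) * 2) by ring.
  apply Rmult_le_compat_l; [|exact S].
  repeat apply Rmult_le_pos; lra.
(* For [c0 <> 0] this is half the difference of the second-order equations, where the B2 terms
   cancel as v1^2 = u1^2 and the C1 terms add up. For [c0 = 0] the equation for f alone gives it,
   since a2 = 0. *)
- assert (X : exists x y : C, Cmod x <= 1 /\ Cmod y <= 1 /\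
    ((lam + 2) * T3 * (a3 - a2 * a2) = gamma * (c0 * B1 * x + c1 * B1 * y))%C).
  { destruct (Ceq_dec c0 0) as [E|Nc0].
    - exists 0, u1; rewrite Cmod_0; split; [lra|]; split; [exact Hu1|].
      rewrite (Hc0 E), E in E2; rewrite (Hc0 E), E.
      transitivity ((lam + 2) * (T3 * a3) + (lam - 1) * (lam + 2) / 2 * (T2 * 0 * (T2 * 0)))%C;
        [field | rewrite E2; ring].
    - exists ((u2 - v2) / 2)%C, u1; split; [|split; [exact Hu1|]].
      + rewrite Cmod_div by (intro E; injection E; lra).
        rewrite Cmod_R, Rabs_pos_eq by lra.
        apply Rle_div_l; [lra|]; eapply Rle_trans; [apply Cmod_triangle|]; rewrite Cmod_opp; lra.
      + rewrite (Hv1 Nc0) in E4.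
        transitivity ((((lam + 2) * (T3 * a3) + (lam - 1) * (lam + 2) / 2 * (T2 * a2 * (T2 * a2)))
         - ((lam + 2) * (T3 * (2 * (a2 * a2) - a3)) + (lam - 1) * (lam + 2) / 2 * (T2 * - a2 * (T2 * - a2)))) / 2)%C;
          [field | rewrite E2, E4; field]. }
  destruct X as [x [y [Hx [Hy EX]]]].
  (* The squared term of the second bound uses only the first-order equation and |u1| <= 1, not the
     bound involving [D]. *)
  assert (M2 : Cmod a2 <= Cmod gamma * Cmod c0 * B1 / ((1 + lam) * T2)).
  { apply Rle_div_r; [apply Rmult_lt_0_compat; lra|].
    apply (f_equal Cmod) in E1; rewrite <- RtoC_plus, !Cmod_mult, HB1m, !Cmod_R, !Rabs_pos_eq in E1 by lra.
    replace (Cmod a2 * ((1 + lam) * T2)) with ((1 + lam) * (T2 * Cmod a2)) by ring.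
    rewrite E1; assert (PR : 0 <= Cmod gamma * (Cmod c0 * B1)) by (repeat apply Rmult_le_pos; lra).
    nra. }
  assert (M3 : Cmod (a3 - a2 * a2) <= Cmod gamma * Cmod c0 * B1 / ((lam + 2) * T3)
    + Cmod gamma * Cmod c1 * B1 / ((lam + 2) * T3)).
  { unfold Rdiv; rewrite <- Rmult_plus_distr_r.
    apply Rle_div_r; [apply Rmult_lt_0_compat; lra|].
    apply (f_equal Cmod) in EX; rewrite <- RtoC_plus, !Cmod_mult, !Cmod_R, !Rabs_pos_eq in EX by lra.
    rewrite Rmult_comm, EX.
    replace (Cmod gamma * Cmod c0 * B1 + Cmod gamma * Cmod c1 * B1)
      with (Cmod gamma * (Cmod c0 * B1 * 1 + Cmod c1 * B1 * 1)) by ring.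
    apply Rmult_le_compat_l; [exact Pg|].
    eapply Rle_trans; [apply Cmod_triangle|]; rewrite !Cmod_mult, HB1m.
    apply Rplus_le_compat; (apply Rmult_le_compat_l; [apply Rmult_le_pos; lra | assumption]). }
  replace a3 with ((a3 - a2 * a2) + a2 * a2)%C by ring.
  eapply Rle_trans; [apply Cmod_triangle|]; rewrite Cmod_mult.
  apply Rplus_le_compat; [exact M3|].
  simpl; rewrite Rmult_1_r; apply Rmult_le_compat; assumption.
Qed.
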